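(* Let $p>3$ be a prime, let $q>5$ be a power of $p$, and let $\mathbb F$ be a field of characteristic $p$. Then there exists a unique (up to isomorphism of graded Lie algebras over $\mathbb F$) Nottingham algebra over $\mathbb F$ with second diamond in degree $q$ and all other diamonds having infinite type, that is, in which every diamond (genuine or fake) other than the first diamond $L_1$ and the second diamond $L_q$ is a diamond of infinite type.
   Context: Lie products are written without commas and are left-normed: $[abc]=[[ab]c]$, and $[ab^i]=[ab\cdots b]$ with $b$ occurring $i$ times. A thin Lie algebra over a field $\mathbb F$ is an infinite-dimensional graded Lie algebra $L=\bigoplus_{i\ge 1}L_i$ over $\mathbb F$ with $\dim L_1=2$, satisfying the covering property: $[zL_1]=L_{i+1}$ for every $i$ and every nonzero $z\in L_i$; it is also required that at least one component $L_i$ with $i>1$ has dimension two. (Components then have dimension $1$ or $2$.) Two-dimensional components are called (genuine) diamonds; $L_1$ is the first diamond, and the two-dimensional component $L_k$ with $k>1$ smallest is the second diamond. A Nottingham algebra is a thin Lie algebra over a field $\mathbb F$ of characteristic $p>3$ whose second diamond is $L_q$, where $q>5$ is a power of $p$. Standard generators: in a Nottingham algebra there is a nonzero $y\in L_1$, unique up to scalars, with $[L_2y]=0$, and one can choose $x\in L_1$ such that $x,y$ is a basis of $L_1$ and, setting $v_1=[yx^{q-2}]$ (which spans $L_{q-1}$), $[v_1xx]=0=[v_1yy]$ and $[v_1yx]=-2[v_1xy]$. Such $x,y$ are called standard generators; each is determined up to a scalar multiple, and the definitions below do not depend on the choice. Types: it is known that no two consecutive components are both two-dimensional. Let $m>1$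 with $\dim L_m=2$ and let $w$ span $L_{m-1}$. $L_m$ is a diamond of finite type $\mu\in\mathbb F$ if $[wxx]=0=[wyy]$ and $\mu[wyx]=(1-\mu)[wxy]$; it is a diamond of infinite type if $[wxx]=0=[wyy]$ and $[wyx]=-[wxy]$. No type is assigned to $L_1$; the second diamond $L_q$ always has type $-1$. Fake diamonds: suppose $m>1$ and $L_{m-1}$ is one-dimensional, spanned by $w$. $L_m$ is a (fake) diamond of type $1$ if $[wxx]=0$ and $[wy]=0$; it is a (fake) diamond of type $0$ if $[wx]=0$ and $[wyy]=0$. Fake diamonds are one-dimensional components, and in particular are not of infinite type. *)

(* Defs.v *)
From HB Require Import structures.
From mathcomp Require Import all_boot all_order all_algebra.
Set Implicit Arguments.
Unset Strict Implicit.
Unset Printing Implicit Defensive.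
Import GRing.Theory.
Local Open Scope ring_scope.

(* Graded by the positive integers: component 0 is the zero subspace. *)
Record gradedLieAlgebra (F : fieldType) := GradedLieAlgebra {
  carrier :> lmodType F;
  bracket : {bilinear carrier -> carrier -> carrier};
  component : nat -> {pred carrier};
  bracketxx : forall a, bracket a a = 0;
  jacobi : forall a b c,
    bracket (bracket a b) c + bracket (bracket b c) a
      + bracket (bracket c a) b = 0;
  component_submod : forall i, submod_closed (component i);
  component0 : component 0 =i pred1 0;
  component_bracket : forall i j a b,
    a \in component i -> b \in component j ->
    bracket a b \in component (i + j);
  component_sum : forall a, exists n (c : nat -> carrier),
    (forall i, c i \in component i) /\ a = \sum_(i < n) c i;
  component_direct : forall n (c : nat -> carrier),
    (forall i, c i \in component i) -> \sum_(i < n) c i = 0 ->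
    forall i, (i < n)%N -> c i = 0
}.

Arguments component {F} _ _.

(* Left associative, so that a ** b ** c is the left-normed product [abc]. *)
Notation "a ** b" := (bracket _ a b)
  (at level 40, left associativity) : ring_scope.

Section Definitions.
Variables (F : fieldType) (L : gradedLieAlgebra F).
Implicit Types (V : {pred L}) (b : seq L) (w x y z : L) (i k m n q : nat).

(* [ab^n] *)
Definition liepow x y n : L := iter n (fun z => z ** y) x.

Definition is_basis V b : Prop :=
  [/\ {subset b <= V},
      forall c : 'I_(size b) -> F,
        \sum_(i < size b) c i *: b`_i = 0 -> forall j, c j = 0
    & forall z, z \in V ->
        exists c : 'I_(size b) -> F, z = \sum_(i < size b) c i *: b`_i].

Definition has_dim V n : Prop := exists2 b, is_basis V b & size b = n.

Definition infinite_dimensional : Prop := forall n, ~ has_dim predT n.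

Definition covering_property : Prop :=
  forall i z, (0 < i)%N -> z \in component L i -> z != 0 ->
  forall w, w \in component L i.+1 <->
            exists2 u, u \in component L 1 & w = z ** u.

(* The covering property says nothing after a zero component.  The third
   clause, usually left implicit, rules out zero components: without it,
   infinite-dimensional abelian algebras with gaps in the grading would
   qualify. *)
Definition thin : Prop :=
  [/\ infinite_dimensional,
      has_dim (component L 1) 2,
      forall i, (0 < i)%N ->
        has_dim (component L i) 1 \/ has_dim (component L i) 2,
      covering_property
    & exists2 i, (1 < i)%N & has_dim (component L i) 2].

Definition second_diamond k : Prop :=
  [/\ (1 < k)%N, has_dim (component L k) 2
    & forall i, (1 < i < k)%N -> ~ has_dim (component L i) 2].

Definition nottingham : Prop :=
  thin /\ exists p h, [/\ p \in [pchar F], (3 < p)%N, (5 < p ^ h)%N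
                        & second_diamond (p ^ h)].

Definition standard_generators q x y : Prop :=
  let v1 := liepow y x (q - 2) in
  [/\ is_basis (component L 1) [:: x; y],
      forall z, z \in component L 2 -> z ** y = 0,
      is_basis (component L q.-1) [:: v1],
      v1 ** x ** x = 0 /\ v1 ** y ** y = 0
    & v1 ** y ** x = (-2) *: (v1 ** x ** y)].

(* From here to is_diamond, x and y are meant to be standard generators. *)
Definition infinite_type x y m : Prop :=
  [/\ (1 < m)%N, has_dim (component L m) 2
    & exists w, [/\ is_basis (component L m.-1) [:: w],
                    w ** x ** x = 0, w ** y ** y = 0
                  & w ** y ** x = - (w ** x ** y)]].

Definition fake_type1 x y m : Prop :=
  (1 < m)%N /\ exists w, [/\ is_basis (component L m.-1) [:: w],
                             w ** x ** x = 0 & w ** y = 0].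

Definition fake_type0 x y m : Prop :=
  (1 < m)%N /\ exists w, [/\ is_basis (component L m.-1) [:: w],
                             w ** x = 0 & w ** y ** y = 0].

Definition is_diamond x y m : Prop :=
  [\/ has_dim (component L m) 2, fake_type1 x y m | fake_type0 x y m].

Definition other_diamonds_infinite q : Prop :=
  exists x y, standard_generators q x y /\
    forall m, (1 < m)%N -> m != q -> is_diamond x y m -> infinite_type x y m.

End Definitions.

Definition graded_isomorphic (F : fieldType) (L M : gradedLieAlgebra F) : Prop :=
  exists f : {linear L -> M},
    [/\ bijective f,
        forall a b, f (a ** b) = f a ** f b
      & forall i a, (f a \in component M i) = (a \in component L i)].

(* Main.v *)
(** Write [t^(i)] for divided powers and [O] for the divided power algebra spanned
    by [t^(0), ..., t^(q-1)].

    Existence: on [F x (+) O[s]], where [x] acts as [d/dt], the bracket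
    [{f, g} = s (f g_0' - g f_0')] (a prime is [d/dt], an index 0 the value at
    [s = 0]) is a Lie bracket: it comes from letting [f] act on [O[s]] as
    multiplication by [s f_0'].  With [y = t^(q-1)], the elements [t^(i) s^j] are
    homogeneous, and the diamonds are spanned by [s^j] and [t^(q-1) s^(j+1)].

    Uniqueness: put [w_a = [y x^a]].  Expanding [[u w_a y] = [u y w_a]], valid
    whenever [[w_a y] = 0], for suitable [u] close to a diamond [[v x], [v y]] gives
    relations [c [v x y x^j y] = 0] with explicit integers [c], one of which is
    nonzero mod [p] but for one exceptional [j]; so [y] centralizes the chain that follows the diamond.  The
    component where the next diamond is expected cannot be one-dimensional, as it
    would be a fake diamond, so it has infinite type.  The same
    expansions, reflected through the second diamond, show [[w_a y] = 0] for
    [a <= q - 3].  Thus all products with [x] and [y] are known, and the evident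
    linear map from the model is an isomorphism. *)

Require Import Defs.
From HB Require Import structures.
From mathcomp Require Import all_boot all_order all_algebra.
From mathcomp Require Import zify ring.
Set Implicit Arguments.
Unset Strict Implicit.
Unset Printing Implicit Defensive.
Import GRing.Theory.
Local Open Scope ring_scope.

(** The Jacobi identity for [{f, g}] needs only that the multiplications by [s f_0'] commute and
    that a bracket, being divisible by [s], acts as zero; [d/dt] is a derivation because [q] is a
    power of [p]. The second diamond differs in type from the later ones because the bracket of
    [t s^j] with [y] contains a coefficient plus its value at [s = 0], which doubles the result for
    [j = 0] only. For uniqueness, an expansion with [w_a] is usable only once [[w_a y] = 0], and at
    first this is given just for [a = 1]. The identity [[w_c w_c] = 0] settles every [a] except odd
    [a] with [p] dividing [a + 1]; only those require reflection. The exceptional [j] is [q - 5]: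
    the parameter 2 of the second diamond produces the coefficient [j + 5], and the substitute
    expansion would need [[w_(q-2) y] = 0], which is false. After later diamonds the parameter is 1,
    the two binomials of a coefficient merge into one by Pascal's rule, and a suitable one is
    nonzero by Lucas' theorem, so no exception remains. *)

Lemma coef_add1Xn (R : comNzRingType) n i :
  ((1 + 'X : {poly R}) ^+ n)`_i = 'C(n, i)%:R.
Proof.
rewrite exprDn coef_sum; under eq_bigr => k _ do rewrite expr1n mul1r coefMn coefXn.
case: (ltnP i n.+1) => [lt_in | le_ni].
  rewrite (bigD1 (Ordinal lt_in)) //= eqxx big1 ?addr0 // => k ne_ki.
  by rewrite eq_sym -val_eqE in ne_ki *; rewrite (negPf ne_ki) mul0rn.
rewrite bin_small // big1 // => k _; rewrite eqn_leq leqNgt.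
by rewrite (leq_trans (ltn_ord k)) // mul0rn.
Qed.

(** * Binomial coefficients modulo p *)

Section PrimePowerBinomials.
Variables (F : fieldType) (p c : nat).
Hypothesis charF : p \in [pchar F].
Local Notation r := (p ^ c)%N.

(** Compare coefficients in [(1 + X)^(r + n) = (1 + X^r) (1 + X)^n], which is Frobenius. *)
Lemma bin_add_primepow n i :
  'C(r + n, i)%:R = 'C(n, i)%:R + (if (r <= i)%N then 'C(n, i - r)%:R else 0) :> F.
Proof.
have charP : p \in [pchar {poly F}] by rewrite pchar_poly.
have prim := pcharf_prime charF.
rewrite -coef_add1Xn exprD exprDn_pchar.
  rewrite expr1n mulrDl mul1r coefD coef_add1Xn mulrC coefMXn coef_add1Xn.
  by case: leqP.
by rewrite pnatX pnatE // charP.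
Qed.

Lemma bin_primepow_mul n i : (0 < i < r)%N -> 'C(r * n, i)%:R = 0 :> F.
Proof.
case/andP=> i_gt0 lt_ir; elim: n => [|n IHn]; first by rewrite muln0 bin_small.
by rewrite mulnS bin_add_primepow IHn leqNgt lt_ir add0r.
Qed.

Lemma bin_primepow n i : n = r -> (0 < i < n)%N -> 'C(n, i)%:R = 0 :> F.
Proof. by move=> -> lt_ir; rewrite -[X in 'C(X, _)]muln1 bin_primepow_mul. Qed.

(** This is the source of nonzero coefficients: when [r] is the full [p]-part of [r n], the value
    [n] is invertible. *)
Lemma bin_primepow_top n t : (t < r)%N -> 'C(r * n + t, r)%:R = n%:R :> F.
Proof.
move=> lt_tr; elim: n => [|n IHn]; first by rewrite muln0 add0n bin_small.
by rewrite mulnS -addnA bin_add_primepow IHn leqnn subnn bin0 -natrD addn1.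
Qed.

(** Pascal's rule applied to the vanishing [C(r n, i + 1)] flips the sign at each step. *)
Lemma sign_bin_pred n i : (i < r)%N -> (0 < r * n)%N ->
  'C((r * n).-1, i)%:R = (-1) ^+ i :> F.
Proof.
move=> + rn_gt0; elim: i => [|i IHi] lt_ir; first by rewrite bin0.
have := bin_primepow_mul n (i := i.+1); rewrite lt_ir => /(_ isT).
rewrite -{1}(prednK rn_gt0) binS natrD IHi ?(ltnW lt_ir) // => /eqP.
by rewrite addr_eq0 exprS mulN1r => /eqP.
Qed.

End PrimePowerBinomials.

(** * Left-normed products in a graded Lie algebra *)

Section LieGeneralities.
Variables (F : fieldType) (L : gradedLieAlgebra F).
Implicit Types (u v w x y z : L).

Lemma br0l u : 0 ** u = 0. Proof. exact: linear0l. Qed.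
Lemma br0r u : u ** 0 = 0. Proof. exact: linear0r. Qed.
Lemma brDl u v w : (u + v) ** w = u ** w + v ** w. Proof. exact: linearDl. Qed.
Lemma brDr u v w : w ** (u + v) = w ** u + w ** v. Proof. exact: linearDr. Qed.
Lemma brNl u w : (- u) ** w = - (u ** w). Proof. exact: linearNl. Qed.
Lemma brZl a u w : (a *: u) ** w = a *: (u ** w). Proof. exact: linearZl_LR. Qed.
Lemma brZr a u w : w ** (a *: u) = a *: (w ** u). Proof. exact: linearZr_LR. Qed.
Lemma br_sumr u n (c : 'I_n -> L) :
  u ** (\sum_(i < n) c i) = \sum_(i < n) u ** c i.
Proof. exact: linear_sumr. Qed.

Lemma brC u v : u ** v = - (v ** u).
Proof.
apply/eqP; rewrite -addr_eq0; apply/eqP.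
by have := bracketxx (u + v); rewrite brDl !brDr !bracketxx add0r addr0.
Qed.

Lemma br_ad u v w : u ** (v ** w) = u ** v ** w - u ** w ** v.
Proof.
apply/eqP; rewrite (brC u (v ** w)) (brC u w) brNl opprK eq_sym -subr_eq0 opprK.
by rewrite addrAC jacobi.
Qed.

(** Expand [[u [x y y]] = 0]. At the end of a chain this supplies the relation [[v y y] = 0] of the
    next diamond. *)
Lemma br_yy u x y : x ** y ** y = 0 -> u ** y = 0 -> u ** x ** y ** y = 0.
Proof.
move=> xyy uy; have := br_ad u (x ** y) y.
by rewrite xyy br0r uy br0l subr0 br_ad uy br0l subr0.
Qed.

Lemma liepowS u x n : liepow u x n.+1 = liepow u x n ** x. Proof. by []. Qed.

Lemma liepowSr u x n : liepow u x n.+1 = liepow (u ** x) x n.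
Proof. exact: iterSr. Qed.

Lemma liepowD u x m n : liepow (liepow u x m) x n = liepow u x (n + m).
Proof. by rewrite /liepow -iterD. Qed.

Lemma liepowZ a u x n : liepow (a *: u) x n = a *: liepow u x n.
Proof. by elim: n => //= n IHn; rewrite IHn brZl. Qed.

Lemma liepow0 x n : liepow (0 : L) x n = 0.
Proof. by elim: n => //= n ->; rewrite br0l. Qed.

Lemma liepow_eq0 u x m n : liepow u x m = 0 -> (m <= n)%N -> liepow u x n = 0.
Proof. by move=> u0 /subnK <-; rewrite -liepowD u0 liepow0. Qed.

(** Right multiplication by [[y x^n]] is an iterated commutator of the right multiplications by [y]
    and [x], hence the alternating binomial expansion. *)
Lemma ad_liepow u x y n :
  u ** liepow y x n =
  \sum_(i < n.+1) ((-1) ^+ i * 'C(n, i)%:R) *: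
     liepow (liepow u x i ** y) x (n - i).
Proof.
elim: n u => [|n IHn] u; first by rewrite big_ord1 bin0 mulr1 scale1r.
rewrite liepowS br_ad IHn IHn.
transitivity (\sum_(i < n.+2) ((-1) ^+ i * 'C(n, i)%:R) *:
     liepow (liepow u x i ** y) x (n.+1 - i) - \sum_(i < n.+1)
   ((-1) ^+ i * 'C(n, i)%:R) *: liepow (liepow (u ** x) x i ** y) x (n - i)).
  congr (_ - _).
  rewrite [in RHS]big_ord_recr /= (@bin_small n n.+1) // mulr0 scale0r addr0.
  rewrite linear_sumlz; apply: eq_bigr => i _.
  by rewrite brZl subSn // -ltnS.
rewrite big_ord_recl [in RHS]big_ord_recl -addrA !bin0; congr (_ + _).
rewrite -sumrB; apply: eq_bigr => i _.
rewrite -liepowSr lift0 subSS exprS mulN1r !mulNr !scaleNr -opprD.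
by rewrite binS natrD mulrDr scalerDl.
Qed.

End LieGeneralities.

(** A diamond [[v x], [v y]] with [[v y x] = - eps [v x y]] has type -1 if
    [eps = 2] and infinite type if [eps = 1]; [dtype k] is the [eps] of the
    [(k+2)]-th diamond. *)
Definition dtype (F : fieldType) (k : nat) : F := if k is 0 then 2 else 1.

Definition diamond_relations (F : fieldType) (L : gradedLieAlgebra F)
    (x y : L) (eps : F) (v : L) : Prop :=
  [/\ v ** x ** x = 0, v ** y ** y = 0 & v ** y ** x = - eps *: (v ** x ** y)].

(** * Chains after a diamond *)

Section Chains.
Variables (F : fieldType) (L : gradedLieAlgebra F) (x y : L).
Implicit Types (u v : L) (eps : F).
Local Notation w a := (liepow y x a).

(** Here [u] lies [s] steps below [v], the element just before a diamond. In [ad_liepow] the terms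
    before [s] vanish by hypothesis and those after [s + 1] because [[v x x] = 0]; the relation for
    [[v y x]] merges the remaining two. *)
Lemma ad_w_diamond u s a eps (v := liepow u x s) :
  v ** x ** x = 0 -> v ** y ** x = - eps *: (v ** x ** y) -> (s < a)%N ->
  (forall i, (i < s)%N -> liepow (liepow u x i ** y) x (a - i) = 0) ->
  u ** w a = ((-1) ^+ s.+1 * (eps * 'C(a, s)%:R + 'C(a, s.+1)%:R)) *:
             liepow (v ** x ** y) x (a - s.+1).
Proof.
move=> vxx vyx lt_sa u0; rewrite ad_liepow.
have lt_s1 : (s < a.+1)%N by rewrite ltnS ltnW.
rewrite (bigD1 (Ordinal lt_s1)) //=.
rewrite (bigD1 (Ordinal (lt_sa : (s.+1 < a.+1)%N))) /=; last first.
  by rewrite -val_eqE /= neq_ltn ltnSn orbT.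
rewrite big1 ?addr0 => [|i /andP[ne1 ne2]]; last first.
  case: (ltngtP i s) => [lt_is | lt_si | eq_is].
  - by rewrite u0 ?scaler0.
  - have ltsi: (s.+2 <= i)%N.
      by move: ne2; rewrite -val_eqE /= => ne2; rewrite ltn_neqAle eq_sym ne2.
    rewrite (@liepow_eq0 _ _ u x s.+2 i) ?br0l ?liepow0 ?scaler0 //.
  - by move: ne1; rewrite -val_eqE /= eq_is eqxx.
rewrite -/v (_ : (a - s = (a - s.+1).+1)%N); last by rewrite -subSn.
rewrite liepowSr vyx liepowZ scalerA -scalerDl exprS; congr (_ *: _); ring.
Qed.

(** Both [u] and [w_a] commute with [y], hence so does [[u w_a]], which [ad_w_diamond] has
    computed. *)
Lemma chain_relation u s a eps (v := liepow u x s) :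
  v ** x ** x = 0 -> v ** y ** x = - eps *: (v ** x ** y) -> (s < a)%N ->
  (forall i, (i < s)%N -> liepow (liepow u x i ** y) x (a - i) = 0) ->
  u ** y = 0 -> w a ** y = 0 ->
  (eps * 'C(a, s)%:R + 'C(a, s.+1)%:R) *:
     (liepow (v ** x ** y) x (a - s.+1) ** y) = 0.
Proof.
move=> vxx vyx lt_sa u0 uy way; have := br_ad u (w a) y.
rewrite way br0r uy br0l subr0 (ad_w_diamond vxx vyx lt_sa u0) brZl -scalerA.
by move/esym/eqP; rewrite scaler_eq0 signr_eq0 => /eqP.
Qed.

Lemma ad_w_vy v a eps : (0 < a)%N -> diamond_relations x y eps v ->
  v ** y ** w a = - eps *: \sum_(i < a)
    ((-1) ^+ i.+1 * 'C(a, i.+1)%:R) *: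
      liepow (liepow (v ** x ** y) x i ** y) x (a - i.+1).
Proof.
move=> a_gt0 [_ vyy vyx]; rewrite ad_liepow big_ord_recl /= vyy liepow0 scaler0.
rewrite add0r scaler_sumr; apply: eq_bigr => i _.
rewrite -[bump 0 i]/i.+1 -[liepow _ x _ ** x]/(liepow (v ** y) x i.+1).
by rewrite liepowSr vyx liepowZ brZl liepowZ !scalerA mulrC.
Qed.

(** The case [u = v], where [[v y]] need not vanish: [[v w_a y] = [v y w_a]] has contributions on
    both sides, and their difference makes the coefficient depend on the parity of [a]. *)
Lemma chain_relation0 v a eps : (0 < a)%N -> diamond_relations x y eps v ->
  w a ** y = 0 ->
  (forall i, (i < a.-1)%N -> liepow (v ** x ** y) x i ** y = 0) ->
  (a%:R + eps - eps * (-1) ^+ a) *: (liepow (v ** x ** y) x a.-1 ** y) = 0.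
Proof.
move=> a_gt0 v_rel way dy0; have [vxx vyy vyx] := v_rel.
have := br_ad v (w a) y; rewrite way br0r.
rewrite (@ad_w_diamond v 0 a eps) //= (ad_w_vy a_gt0 v_rel).
case: a a_gt0 way dy0 => // a _ way dy0; rewrite big_ord_recr big1 /= => [|i _].
  rewrite bin0 bin1 binn subnn subSS subn0 add0r brZl scalerA -scalerBl => /esym.
  move=> eq0; rewrite -[RHS](scaler0 _ (-1)) -[in RHS]eq0 scalerA; congr (_ *: _).
  by rewrite expr1; ring.
by rewrite dy0 // liepow0 scaler0.
Qed.
End Chains.

(** * Thin algebras *)

Section Bases.
Variables (F : fieldType) (L : gradedLieAlgebra F) (V : {pred L}).
Implicit Types u v z : L.

Lemma basis1P v : is_basis V [:: v] <->
  [/\ v \in V, v != 0 & forall z, z \in V -> exists a, z = a *: v].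
Proof.
split=> [[sub indep span] | [vV v0 span]].
  split=> [||z /span[c ->]]; first by rewrite sub ?mem_head.
    apply/eqP=> v0; have /(_ _ ord0)/eqP := indep (fun=> 1).
    by rewrite big_ord1 /= v0 scaler0 oner_eq0 => /(_ erefl).
  by exists (c ord0); rewrite big_ord1.
split=> [z | c | z /span[a ->]].
- by rewrite inE => /eqP->.
- rewrite big_ord1 /= => /eqP; rewrite scaler_eq0 (negPf v0) orbF => /eqP c0 j.
  by rewrite (ord1 j).
- by exists (fun=> a); rewrite big_ord1.
Qed.

Lemma basis2P u v : is_basis V [:: u; v] <->
  [/\ u \in V, v \in V, forall a b, a *: u + b *: v = 0 -> a = 0 /\ b = 0
    & forall z, z \in V -> exists a b, z = a *: u + b *: v].
Proof.
split=> [[sub indep span] | [uV vV indep span]].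
  split=> [||a b ab0|z /span[c ->]].
  - by rewrite sub ?mem_head.
  - by rewrite sub ?inE ?eqxx ?orbT.
  - have := indep (fun i => [:: a; b]`_i).
    rewrite big_ord_recl big_ord1 /= ab0 => /(_ erefl) c0.
    by split; [apply: (c0 ord0) | apply: (c0 (Ordinal (isT : 1 < 2)%N))].
  - exists (c ord0), (c (lift ord0 ord0)).
    by rewrite big_ord_recl big_ord1.
split=> [z | c | z /span[a [b ->]]].
- by rewrite !inE => /orP[] /eqP->.
- rewrite big_ord_recl big_ord1 /= => /indep[c0 c1] j.
  by case: (unliftP ord0 j) => [i|] -> //; rewrite (ord1 i).
- by exists (fun i => [:: a; b]`_i); rewrite big_ord_recl big_ord1.
Qed.

Lemma has_dim1 v : is_basis V [:: v] -> has_dim V 1.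
Proof. by exists [:: v]. Qed.

Lemma has_dim2 u v : is_basis V [:: u; v] -> has_dim V 2.
Proof. by exists [:: u; v]. Qed.

Lemma has_dim1_basis v : has_dim V 1 -> v \in V -> v != 0 -> is_basis V [:: v].
Proof.
case=> -[|u [|? ?]] // /basis1P[uV u0 span] _ vV v0; apply/basis1P; split=> // z.
have [b ev] := span _ vV; have b0 : b != 0.
  by apply: contraNneq v0 => b0; rewrite ev b0 scale0r.
by case/span=> a ->; exists (a / b); rewrite ev scalerA divfK.
Qed.

Lemma has_dim2_nspan v : has_dim V 2 ->
  ~ forall z, z \in V -> exists a, z = a *: v.
Proof.
case=> -[|u [|w [|? ?]]] // /basis2P[uV wV indep _] _ span.
have [[a eu] [b ew]] := (span _ uV, span _ wV).
have [|_ /eqP] := indep b (- a).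
  by rewrite eu ew !scalerA -scalerDl mulrC mulNr subrr scale0r.
rewrite oppr_eq0 => /eqP a0; have [|/eqP] := indep 1 0.
  by rewrite eu a0 !scale0r scaler0 addr0.
by rewrite oner_eq0.
Qed.

Lemma has_dim2_nbasis v : has_dim V 2 -> ~ is_basis V [:: v].
Proof. by move=> dim2 /basis1P[_ _]; apply: has_dim2_nspan. Qed.
End Bases.

Section ThinAlgebras.
Variables (F : fieldType) (L : gradedLieAlgebra F) (x y : L).
Hypotheses (thinL : thin L) (xyP : is_basis (component L 1) [:: x; y]).
Implicit Types (u v z : L) (n : nat).

Lemma comp0 n : 0 \in component L n.
Proof. by have [] := component_submod L n. Qed.

Lemma compZ n a u : u \in component L n -> a *: u \in component L n.
Proof.
by move=> uV; have [V0 VP] := component_submod L n; rewrite -[a *: u]addr0 VP.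
Qed.

Lemma compD n u v :
  u \in component L n -> v \in component L n -> u + v \in component L n.
Proof.
by move=> uV vV; have [V0 VP] := component_submod L n; rewrite -[u]scale1r VP.
Qed.

Lemma x_comp : x \in component L 1. Proof. by case/basis2P: xyP. Qed.
Lemma y_comp : y \in component L 1. Proof. by case/basis2P: xyP. Qed.

Lemma comp_x n u : u \in component L n -> u ** x \in component L n.+1.
Proof. by move=> uV; rewrite -addn1 component_bracket ?x_comp. Qed.

Lemma comp_y n u : u \in component L n -> u ** y \in component L n.+1.
Proof. by move=> uV; rewrite -addn1 component_bracket ?y_comp. Qed.

Lemma comp_liepow n u i :
  u \in component L n -> liepow u x i \in component L (n + i).
Proof. by move=> uV; elim: i => [|i IHi]; rewrite ?addn0 ?addnS ?comp_x. Qed.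

Lemma cover n z u : (0 < n)%N -> z \in component L n -> z != 0 ->
  u \in component L n.+1 -> exists a b, u = a *: (z ** x) + b *: (z ** y).
Proof.
case: thinL => _ _ _ covering _ n_gt0 zV z0.
case/(covering n z n_gt0 zV z0 u) => t tV ->.
have [_ _ _ /(_ t tV)[a [b ->]]] := (basis2P (component L 1) x y).1 xyP.
by exists a, b; rewrite brDr !brZr.
Qed.

Lemma comp_neq0 n : (0 < n)%N -> exists2 z, z \in component L n & z != 0.
Proof.
case: thinL => _ _ dims _ _ /dims[] [].
  case=> [|v [|? ?]] // /basis1P[vV v0 _] _; by exists v.
case=> [|u [|v [|? ?]]] // /basis2P[uV vV indep _] _; exists u => //.
apply/eqP=> u0; have [|/eqP] := indep 1 0; last by rewrite oner_eq0.
by rewrite u0 scaler0 scale0r addr0.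
Qed.

(** Otherwise covering would make the next component zero. *)
Lemma alive n z : (0 < n)%N -> z \in component L n -> z ** x = 0 ->
  z ** y = 0 -> z = 0.
Proof.
move=> n_gt0 zV zx zy; apply/eqP/negPn/negP=> z0.
have [u uV] := comp_neq0 (ltn0Sn n).
have [a [b ->]] := cover n_gt0 zV z0 uV.
by rewrite zx zy !scaler0 addr0 eqxx.
Qed.

Lemma dim12 n : (0 < n)%N -> has_dim (component L n) 1 \/ has_dim (component L n) 2.
Proof. by case: thinL => _ _ dims _ _; apply: dims. Qed.

Lemma basis_next n v : (0 < n)%N -> v \in component L n -> v != 0 -> v ** y = 0 ->
  is_basis (component L n.+1) [:: v ** x].
Proof.
move=> n_gt0 vV v0 vy; apply/basis1P; split=> [||z /(cover n_gt0 vV v0)[a [b ->]]].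
- exact: comp_x.
- by apply: contraNneq v0 => vx; apply/eqP/(alive n_gt0).
- by exists a; rewrite vy scaler0 addr0.
Qed.

Lemma chain_basis n v i : (0 < n)%N -> is_basis (component L n) [:: v] ->
  (forall j, (j < i)%N -> liepow v x j ** y = 0) ->
  is_basis (component L (n + i)) [:: liepow v x i].
Proof.
move=> n_gt0 vP; elim: i => [|i IHi] vy0; first by rewrite addn0.
have [|viV vi0 _] := (basis1P _ _).1 (IHi _); first by move=> j lt_ji; apply: vy0; lia.
by rewrite addnS; apply: basis_next viV vi0 _; rewrite ?vy0 //; lia.
Qed.

Lemma diamond_vx_neq0 n v : (0 < n)%N -> is_basis (component L n) [:: v] ->
  has_dim (component L n.+1) 2 -> v ** x != 0.
Proof.
move=> n_gt0 /basis1P[vV v0 _] dim2; apply/eqP => vx.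
apply: (has_dim2_nspan (v := v ** y) dim2) => z /(cover n_gt0 vV v0)[a [b ->]].
by exists b; rewrite vx scaler0 add0r.
Qed.

Lemma diamond_bottom n v : (0 < n)%N -> is_basis (component L n) [:: v] ->
  has_dim (component L n.+1) 2 -> v ** x ** x = 0 ->
  is_basis (component L n.+2) [:: v ** x ** y].
Proof.
move=> n_gt0 vP dim2 vxx; have vx0 := diamond_vx_neq0 n_gt0 vP dim2.
have /basis1P[vV _ _] := vP; have vxV := comp_x vV.
apply/basis1P; split=> [||z /(cover (ltn0Sn n) vxV vx0)[a [b ->]]].
- exact: comp_y.
- by apply: contraNneq vx0 => vxy; apply/eqP/(alive (ltn0Sn n)).
- by exists b; rewrite vxx scaler0 add0r.
Qed.

Lemma infinite_type_basis n v : is_basis (component L n) [:: v] ->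
  infinite_type x y n.+1 -> diamond_relations x y 1 v.
Proof.
case/basis1P=> vV _ _ [_ _ [w [/basis1P[_ _ wP] wxx wyy wyx]]].
have [a ->] := wP _ vV.
by split; rewrite !brZl ?wxx ?wyy ?wyx ?scaler0 // scaleN1r scalerN.
Qed.
End ThinAlgebras.

Section SmallBinomials.
Variables (F : fieldType) (p : nat).
Hypotheses (charF : p \in [pchar F]) (p_gt3 : (3 < p)%N).

Lemma natr_eq0 n : (n%:R == 0 :> F) = (p %| n)%N.
Proof. by rewrite (dvdn_pcharf charF). Qed.

Lemma natr2_neq0 : 2%:R != 0 :> F.
Proof. by rewrite natr_eq0 gtnNdvd // ltnW. Qed.

Lemma natr3_neq0 : 3%:R != 0 :> F.
Proof. by rewrite natr_eq0 gtnNdvd. Qed.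

Lemma natr_bin2 n : 2%:R * 'C(n, 2)%:R = n%:R * (n%:R - 1) :> F.
Proof.
case: n => [|n]; first by rewrite bin0n mulr0 mul0r.
by rewrite -natrM mulnC bin_ffact ffactnS ffactn1 natrM -natr1 addrK.
Qed.

Lemma natr_bin3 n :
  2%:R * 3%:R * 'C(n, 3)%:R = n%:R * (n%:R - 1) * (n%:R - 2%:R) :> F.
Proof.
case: n => [|[|n]]; first by rewrite bin0n mulr0 !mul0r.
  by rewrite bin_small // subrr !mulr0 mul0r.
have -> : n.+2%:R - 2%:R = n%:R :> F by rewrite -addn2 natrD addrK.
have -> : n.+2%:R - 1 = n.+1%:R :> F by rewrite -natr1 addrK.
by rewrite -!natrM mulnC (bin_ffact n.+2 3) !ffactnS ffactn0 muln1 mulnA.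
Qed.
End SmallBinomials.

(** * The structure of a Nottingham algebra *)

Section FirstChain.
Variables (F : fieldType) (L : gradedLieAlgebra F) (x y : L) (p q : nat).
Hypotheses (charF : p \in [pchar F]) (p_gt3 : (3 < p)%N) (q_gt5 : (5 < q)%N).
Hypothesis q_odd : odd q.
Hypotheses (thinL : thin L) (xyP : is_basis (component L 1) [:: x; y]).
Local Notation w i := (liepow y x i).
Local Notation v1 := (w (q - 2)).
Local Notation d := (v1 ** x ** y).
Hypothesis comp2y : forall z, z \in component L 2 -> z ** y = 0.
Hypothesis v1_rel : diamond_relations x y 2 v1.
Hypothesis v1_basis : is_basis (component L (q - 1)) [:: v1].
Hypothesis dim_q : has_dim (component L q) 2.
Hypothesis dim_lt_q : forall i, (1 < i < q)%N -> ~ has_dim (component L i) 2.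

Lemma xyy : x ** y ** y = 0.
Proof. by apply: comp2y; exact: (comp_y xyP (x_comp xyP)). Qed.

Lemma w_comp i : w i \in component L i.+1.
Proof. exact: (comp_liepow xyP i (y_comp xyP)). Qed.

Lemma w_neq0 i : (i <= q - 2)%N -> w i != 0.
Proof.
move=> le_iq; case/basis1P: v1_basis => _ + _.
by apply: contraNneq => wi0; rewrite (liepow_eq0 wi0).
Qed.

Lemma w_basis i : (0 < i <= q - 2)%N -> is_basis (component L i.+1) [:: w i].
Proof.
case/andP=> i_gt0 le_iq; apply: has_dim1_basis (w_comp i) (w_neq0 le_iq).
by case: (dim12 thinL (ltn0Sn i)) => // /dim_lt_q[]; lia.
Qed.

Lemma w_eq0 i : (q <= i)%N -> w i = 0.
Proof.
move=> le_qi; case: v1_rel => v1xx _ _; apply: (@liepow_eq0 _ _ y x q) => //.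
by rewrite (_ : q = (q - 2).+2) //; lia.
Qed.

Lemma w_y i : (i <= q - 3)%N -> exists k, w i ** y = k *: w i.+1.
Proof.
move=> le_iq; have /basis1P[_ _] : is_basis (component L i.+2) [:: w i.+1].
  by apply: w_basis; lia.
by apply; exact: (comp_y xyP (w_comp i)).
Qed.

Lemma w_yx_eq0 i n : (i <= q - 3)%N -> (q <= i.+1 + n)%N ->
  liepow (w i ** y) x n = 0.
Proof.
move=> le_iq le_q; have [k ->] := w_y le_iq.
by rewrite liepowZ liepowD w_eq0 ?scaler0 // addnC.
Qed.

Lemma q_pred : (q - 1).+1 = q. Proof. lia. Qed.

Lemma d_basis : is_basis (component L q.+1) [:: d].
Proof.
have [v1xx _ _] := v1_rel; have q1_gt0 : (0 < q - 1)%N by lia.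
have := diamond_bottom thinL xyP q1_gt0 v1_basis _ v1xx.
by rewrite q_pred; apply.
Qed.

Lemma d_neq0 : d != 0.
Proof. by case/basis1P: d_basis. Qed.

(* Expands [[w_b w_a y] = [w_b y w_a]] for [a + b = q - 2], in degree [q + 1]. *)
Lemma top_relation a k : (0 < a <= q - 3)%N -> w a ** y = 0 ->
  (forall i, (0 < i < a)%N -> w (q - 2 - i) ** y = 0) ->
  w (q - 2 - a) ** y = k *: w (q - 2 - a).+1 ->
  (1 - (-1) ^+ a * (2 * a%:R + 1)) * k = 0.
Proof.
case/andP=> a_gt0 le_aq way top0 wby.
have [v1xx v1yy v1yx] := v1_rel.
have := br_ad (w (q - 2 - a)) (w a) y; rewrite way br0r wby brZl.
have -> : w (q - 2 - a) ** w a = k *: (v1 ** x) + (-1) ^+ a *: (v1 ** y).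
  rewrite ad_liepow (bigD1 ord0) //= (bigD1 ord_max) /=; last first.
    by rewrite -val_eqE /= -lt0n.
  rewrite big1 ?addr0 => [|[i /= lt_ia] /andP[]]; last first.
    rewrite -!val_eqE /= => ne0 nea; rewrite liepowD.
    have -> : (i + (q - 2 - a) = q - 2 - (a - i))%N by lia.
    by rewrite top0 ?liepow0 ?scaler0 //; lia.
  rewrite bin0 binn subn0 subnn !mulr1 scale1r wby liepowZ !liepowD.
  have -> : (a + (q - 2 - a).+1 = (q - 2).+1)%N by lia.
  by have -> : (a + (q - 2 - a) = q - 2)%N by lia.
have v1E : liepow (w (q - 2 - a).+1) x a.-1 = v1.
  by rewrite liepowD; congr (liepow _ _ _); lia.
rewrite (@ad_w_diamond _ _ _ _ (w (q - 2 - a).+1) a.-1 a 2) ?v1E //; first last.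
- move=> i lt_i; rewrite liepowD.
  rewrite (_ : (i + (q - 2 - a).+1 = q - 2 - (a - i.+1))%N); last lia.
  by rewrite top0 ?liepow0 //; lia.
- by rewrite prednK.
rewrite prednK // subnn binn brDl !brZl v1yy scaler0 addr0 scalerA -scalerBl.
move=> /esym/eqP; rewrite scaler_eq0 (negPf d_neq0) orbF => /eqP <-.
rewrite -[in 'C(a, _)](prednK a_gt0) binSn prednK //; ring.
Qed.

Lemma top_eq0 a : (0 < a <= q - 3)%N -> w a ** y = 0 ->
  (forall i, (0 < i < a)%N -> w (q - 2 - i) ** y = 0) ->
  1 - (-1) ^+ a * (2 * a%:R + 1) != 0 :> F -> w (q - 2 - a) ** y = 0.
Proof.
move=> aP way top0 nz; have [|k ky] := w_y (i := (q - 2 - a)%N); first by lia.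
have /eqP := top_relation aP way top0 ky.
by rewrite mulf_eq0 (negPf nz) ky => /eqP->; rewrite scale0r.
Qed.

(** The coefficient in [top_relation] is 4 for [a = 1] and -4 for [a = 2]. The two vanishing
    products make [w_(q-3)] and [w_(q-4)] available as starting points [u] in [first_chain]. *)
Lemma top12 : (forall i, (i < 3)%N -> w i ** y = 0) ->
  forall i, (0 < i < 3)%N -> w (q - 2 - i) ** y = 0.
Proof.
have n4 : 2 * 2 != 0 :> F by rewrite mulf_neq0 ?(natr2_neq0 charF).
move=> wy0; have top1 : w (q - 2 - 1) ** y = 0.
  apply: top_eq0; rewrite ?wy0 //; try lia.
  by rewrite (_ : _ - _ = 2 * 2) //; ring.
case=> [|[|[|i]]] // _; apply: top_eq0; rewrite ?wy0 //; try lia.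
  by case=> [|[|i]].
by rewrite (_ : _ - _ = - (2 * 2)) ?oppr_eq0 //; ring.
Qed.

(** [chain_relation0] with [a = j + 1] has coefficient [j + 1] for odd [j] and [j + 5] for even [j].
    If [p] divides it, start [s = 1], respectively [s = 2], steps earlier: the coefficient becomes 2
    modulo [p], at the price of using the larger index [a = j + s + 1], which must stay below [m].
    The bound [m] is a parameter because the lemma serves both while [[w_i y] = 0] is being proved
    and afterwards, with [m = q - 2]. *)
Lemma first_chain m j : (forall i, (i < m)%N -> w i ** y = 0) ->
  (3 <= m <= q - 2)%N -> (j.+1 < m)%N ->
  (forall i, (i < j)%N -> liepow d x i ** y = 0) ->
  (odd j -> (p %| j.+1)%N -> (j.+2 < m)%N) ->
  (~~ odd j -> (p %| j + 5)%N -> (j.+3 < m)%N) ->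
  liepow d x j ** y = 0.
Proof.
move=> wy0 /andP[m_ge3 le_mq] lt_jm dy0 odd_j even_j.
have [v1xx v1yy v1yx] := v1_rel.
have n2 := natr2_neq0 charF p_gt3; have n3 := natr3_neq0 charF p_gt3.
have top0 := top12 (fun i lt_i3 => wy0 i (leq_trans lt_i3 m_ge3)).
have rel s : (0 < s < 3)%N -> (j + s.+1 < m)%N ->
    2 * 'C(j + s.+1, s)%:R + 'C(j + s.+1, s.+1)%:R != 0 :> F ->
    liepow d x j ** y = 0.
  move=> s3 lt_jsm nz; have v1E : liepow (w (q - 2 - s)) x s = v1.
    by rewrite liepowD subnKC //; lia.
  have := @chain_relation _ _ x y (w (q - 2 - s)) s (j + s.+1) 2.
  rewrite v1E addnK (wy0 _ lt_jsm) (top0 s s3).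
  have ys i : (i < s)%N -> liepow (w (q - 2 - s)) x i ** y = 0.
    move=> lt_is; rewrite liepowD (_ : (i + _ = q - 2 - (s - i))%N); last lia.
    by rewrite top0 //; lia.
  move/(_ v1xx v1yx _ _ erefl erefl)/eqP; rewrite scaler_eq0 (negPf nz) /= => eq0.
  by apply/eqP/eq0=> [|i lt_is]; [lia | rewrite ys ?liepow0].
have := chain_relation0 (ltn0Sn j) v1_rel (wy0 _ lt_jm) dy0.
rewrite /= -signr_odd /=; case: (boolP (odd j)) => [j_odd | j_even] /=.
  rewrite expr0 mulr1 addrK => /eqP; rewrite scaler_eq0 (natr_eq0 charF).
  case/orP=> [p_j | /eqP//]. apply: (rel 1%N) => //; first by rewrite addn2 odd_j.
  have jE : j%:R = -1 :> F.
    by apply/eqP; rewrite -subr_eq0 opprK natr1 (natr_eq0 charF).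
  have E : 2 * (2 * (j + 2)%:R + 'C(j + 2, 2)%:R) = 2 * 2 :> F.
    by rewrite mulrDr natr_bin2 natrD jE; ring.
  by rewrite bin1; apply: contraNneq (mulf_neq0 n2 n2) => eq0; rewrite -E eq0 mulr0.
rewrite expr1 (_ : _ - _ = (j + 5)%:R); last by rewrite -natr1 natrD; ring.
move/eqP; rewrite scaler_eq0 (natr_eq0 charF) => /orP[p_j | /eqP//].
apply: (rel 2%N) => //; first by rewrite addn3 even_j.
have jE : j%:R = - 5%:R :> F.
  by apply/eqP; rewrite -subr_eq0 opprK -natrD (natr_eq0 charF).
have E : 2 * 3%:R * (2 * 'C(j + 3, 2)%:R + 'C(j + 3, 3)%:R) = 2 * 2 * 3%:R :> F.
  by rewrite mulrDr natr_bin3 natr_bin2 natrD jE; ring.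
apply: contraNneq (mulf_neq0 (mulf_neq0 n2 n2) n3) => eq0; rewrite -E eq0 mulr0 //.
Qed.

(* Expands [[w_b [w_m y]] = [w_b w_m y] - [w_b y w_m]] for [b = q - 2 - s], which
   lies beyond the second diamond: a nonzero [[w_m y]] is reflected through
   that diamond. *)
Lemma reflected_relation m s k l : (0 < s < m)%N -> (m <= q - 4)%N ->
  w m ** y = l *: w m.+1 ->
  w (q - 2 - s) ** y = k *: w (q - 2 - s).+1 ->
  liepow d x (m - s.+1) ** y = 0 ->
  k * (2 * 'C(m, s.-1)%:R + 'C(m, s)%:R) *: liepow d x (m - s) =
  l * (2 * 'C(m.+1, s)%:R + 'C(m.+1, s.+1)%:R) *: liepow d x (m - s).
Proof.
case/andP=> s_gt0 lt_sm le_mq wmy wby dy0; have [v1xx v1yy v1yx] := v1_rel.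
have v1E : liepow (w (q - 2 - s)) x s = v1 by rewrite liepowD subnKC //; lia.
have v1E' : liepow (w (q - 2 - s).+1) x s.-1 = v1.
  by rewrite liepowD; congr (liepow _ _ _); lia.
have small a i : (i < s)%N -> (m <= a)%N ->
    liepow (liepow (w (q - 2 - s)) x i ** y) x (a - i) = 0.
  by move=> lt_is le_ma; rewrite liepowD w_yx_eq0 //; lia.
have small' i : (i < s.-1)%N ->
    liepow (liepow (w (q - 2 - s).+1) x i ** y) x (m - i) = 0.
  by move=> lt_is; rewrite liepowD w_yx_eq0 //; lia.
have := br_ad (w (q - 2 - s)) (w m) y; rewrite wmy brZr wby brZl.
have E1 := @ad_w_diamond _ _ x y (w (q - 2 - s)) s m.+1 2.
rewrite v1E in E1; rewrite {}E1 //; [|by lia|by move=> i lt_is; apply: small].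
have E1 := @ad_w_diamond _ _ x y (w (q - 2 - s)) s m 2.
rewrite v1E in E1; rewrite {}E1 //; [|by move=> i lt_is; apply: small].
have E1 := @ad_w_diamond _ _ x y (w (q - 2 - s).+1) s.-1 m 2.
rewrite v1E' in E1; rewrite {}E1 //; [|by lia].
rewrite brZl dy0 scaler0 sub0r prednK // subSS !scalerA => E.
have nz : (-1) ^+ s.+1 != 0 :> F by rewrite signr_eq0.
apply: (scalerI nz); apply/esym.
rewrite scalerA [_ * (l * _)]mulrCA E -scaleNr scalerA; congr (_ *: _).
by rewrite exprS; ring.
Qed.

(** In the expansion of [[w_c w_c] = 0] only the last term survives. *)
Lemma w_y_even c : (forall i, (i < c.*2)%N -> w i ** y = 0) -> w c.*2 ** y = 0.
Proof.
move=> wy0; have := bracketxx (w c); rewrite ad_liepow big_ord_recr big1 => [|i _].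
  rewrite /= add0r binn mulr1 subnn liepowD addnn /=.
  by move/eqP; rewrite scaler_eq0 signr_eq0 => /eqP.
rewrite liepowD /= wy0 ?liepow0 ?scaler0 //.
by rewrite -addnn ltn_add2r ltn_ord.
Qed.

(** If [[w_m y]] is nonzero, it is a nonzero multiple of [w_(m+1)], so [[w_m y y] = 0] gives
    [[w_(m+1) y] = 0]. Then [[w_c w_c] = 0] reduces to [c [w_m y x] = 0], and unless [p] divides [c]
    covering forces [[w_m y] = 0]. *)
Lemma w_y_odd m c : (m.+1 = c.*2)%N -> (0 < c)%N -> (m <= q - 4)%N ->
  (forall i, (i < m)%N -> w i ** y = 0) -> (p %| m.+1)%N \/ w m ** y = 0.
Proof.
move=> mE c_gt0 le_mq wy0.
have [|l wmy] := w_y (i := m); first by lia.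
have [l0 | l0] := eqVneq l 0; first by right; rewrite wmy l0 scale0r.
have wmyy : w m ** y ** y = 0.
  have -> : m = m.-1.+1 by lia.
  by apply: br_yy xyy _; apply: wy0; lia.
have w1y : w m.+1 ** y = 0.
  by apply: (scalerI l0); rewrite -brZl -wmy wmyy scaler0.
have := bracketxx (w c); case: c c_gt0 mE => // c _ mE.
rewrite ad_liepow big_ord_recr big_ord_recr big1 => [|i _]; last first.
  rewrite liepowD wy0 ?liepow0 ?scaler0 //=.
  by have := ltn_ord i; lia.
rewrite /= add0r -!liepowSr liepowD (_ : (c.+1 + c = m)%N); last by lia.
rewrite -[liepow y x m ** x]/(w m.+1) w1y liepow0 scaler0 addr0 binSn subSnn /=.
move/eqP; rewrite scaler_eq0 mulf_eq0 signr_eq0 (natr_eq0 charF) /=.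
case/orP=> [p_c | /eqP wmyx]; first by left; rewrite mE -muln2 dvdn_mulr.
right; apply: (alive thinL xyP _ _ wmyx wmyy); last exact: (comp_y xyP (w_comp m)).
by [].
Qed.

(** The side conditions of [first_chain] could fail only within two steps of [m], where divisibility
    of [m + 1] would make [p] divide 1 or 2. *)
Lemma d_chain_below m : (forall i, (i < m)%N -> w i ** y = 0) ->
  (3 <= m <= q - 3)%N -> odd m -> (p %| m.+1)%N ->
  forall j, (j.+1 < m)%N -> liepow d x j ** y = 0.
Proof.
move=> wy0 m3 m_odd p_m j; elim/ltn_ind: j => j IHj lt_jm.
apply: (first_chain wy0) => //; first by lia.
- by move=> i lt_ij; apply: IHj; lia.
- move=> j_odd p_j; rewrite ltnNge; apply/negP=> le_mj.
  have : (p %| m.+1 - j.+1)%N by rewrite dvdn_sub.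
  by rewrite (_ : m.+1 - j.+1 = 2)%N ?gtnNdvd //; lia.
- move=> j_even p_j; rewrite ltnNge; apply/negP=> le_mj.
  have : (p %| j + 5 - m.+1)%N by rewrite dvdn_sub.
  have [->|->] : (j + 5 - m.+1 = 1 \/ j + 5 - m.+1 = 2)%N by lia.
    by rewrite gtnNdvd //; lia.
  by rewrite gtnNdvd //; lia.
Qed.

(* Let [r] be the [p]-part of [m + 1].  Reflection makes [[w_b y]] vanish for
   [q - 1 - r < b <= q - 3] but not for [b = q - 1 - r], where [top_relation]
   forces it to vanish. *)
Lemma w_y_primepow m : (forall i, (i < m)%N -> w i ** y = 0) ->
  (3 <= m <= q - 4)%N -> odd m -> (p %| m.+1)%N -> w m ** y = 0.
Proof.
move=> wy0 m3 m_odd p_m; have p_prime := pcharf_prime charF.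
have [//|n co_pn mE] := @pfactor_coprime p m.+1 p_prime.
set e := logn p m.+1 in mE.
have e_gt0 : (0 < e)%N by rewrite logn_gt0 mem_primes p_prime.
have r_odd : odd (p ^ e) by rewrite oddX; case: (even_prime p_prime); lia.
have n_even : ~~ odd n.
  by move: m_odd; apply: contraL => n_odd; have := oddM n (p ^ e); rewrite -mE; lia.
have r_ge3 : (3 < p ^ e)%N.
  by apply: leq_trans p_gt3 _; rewrite -{1}(expn1 p) leq_exp2l //; lia.
(* The cofactor [n] is even, hence at least 2; so [r < m], and all indices up to [r] are covered by
   the induction hypothesis. *)
have [n_gt1 r_lt_m] : (1 < n)%N /\ (p ^ e < m)%N.
  by case: n n_even mE {co_pn} => [|[|n]] // _ mE; split=> //; nia.
have mE' : m = (p ^ e * n).-1 by rewrite mulnC -mE.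
have rn_gt0 : (0 < p ^ e * n)%N by lia.
have [|l wmy] := w_y (i := m); first by lia.
have dy0 : forall j, (j.+1 < m)%N -> liepow d x j ** y = 0.
  by apply: d_chain_below => //; lia.
have dx0 s : (0 < s < m)%N -> liepow d x (m - s) != 0.
  move=> sP; have chain := chain_basis thinL xyP (i := (m - s)%N) (ltn0Sn q) d_basis.
  have [|_ + _] := (basis1P _ _).1 (chain _) => //.
  by move=> i lt_i; apply: dy0; lia.
(* Since [m = r n - 1], the binomials [C(m, s-1)] and [C(m, s)] are signs and [C(m+1, s)] vanishes,
   which simplifies both sides of [reflected_relation]. *)
have rel s k : (0 < s < p ^ e)%N -> w (q - 2 - s) ** y = k *: w (q - 2 - s).+1 ->
    k * (-1) ^+ s.-1 = l * 'C(m.+1, s.+1)%:R.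
  move=> sP wby; have sm : (0 < s < m)%N by lia.
  have := reflected_relation sm _ wmy wby _; rewrite dy0; last by lia.
  move=> E; have /eqP : _ = _ := E ltac:(lia) erefl.
  rewrite -subr_eq0 -scalerBl scaler_eq0 (negPf (dx0 _ sm)) orbF subr_eq0.
  rewrite mE mulnC (bin_primepow_mul charF _ sP) mulr0 add0r => /eqP <-.
  rewrite mE' !(sign_bin_pred charF) //; try lia.
  by case: s sP {wby sm E} => // s sP /=; rewrite exprS; congr (_ * _); ring.
have top0 s : (0 < s < (p ^ e).-1)%N -> w (q - 2 - s) ** y = 0.
  move=> sP; have [|k ky] := w_y (i := (q - 2 - s)%N); first by lia.
  have sP' : (0 < s.+1 < p ^ e)%N by lia.
  have /eqP := rel s k ltac:(lia) ky; rewrite mE mulnC (bin_primepow_mul charF _ sP').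
  by rewrite mulr0 mulf_eq0 signr_eq0 orbF ky => /eqP->; rewrite scale0r.
have [|k ky] := w_y (i := (q - 2 - (p ^ e).-1)%N); first by lia.
(* For [a = r - 1], which is even and equal to -1 in the field, the coefficient in [top_relation] is
   2. On the other side [rel] equates [k], up to sign, with [l C(r n, r) = l n], so [l = 0]. *)
have k0 : k = 0.
  have r1_y : w (p ^ e).-1 ** y = 0 by apply: wy0; lia.
  have := top_relation (a := (p ^ e).-1) ltac:(lia) r1_y top0 ky.
  rewrite -signr_odd (_ : odd (p ^ e).-1 = false); last by lia.
  have -> : (p ^ e).-1%:R = -1 :> F.
    apply/eqP; rewrite -subr_eq0 opprK natr1 prednK ?(natr_eq0 charF) ?dvdn_exp //.
    by lia.
  have n2 := natr2_neq0 charF p_gt3.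
  by rewrite (_ : 1 - _ = 2); [move/eqP; rewrite mulf_eq0 (negPf n2) => /eqP | ring].
have := rel (p ^ e).-1 k ltac:(lia) ky; rewrite prednK; last by lia.
rewrite mE mulnC -[(p ^ e * n)%N]addn0 (bin_primepow_top charF) //; last by lia.
rewrite k0 mul0r => /esym/eqP; rewrite mulf_eq0 (natr_eq0 charF).
rewrite (prime_coprime _ p_prime) in co_pn.
by rewrite (negPf co_pn) orbF wmy => /eqP->; rewrite scale0r.
Qed.

Lemma w_y_eq0 i : (i <= q - 3)%N -> w i ** y = 0.
Proof.
elim/ltn_ind: i => m IHm le_mq.
have wy0 i : (i < m)%N -> w i ** y = 0 by move=> lt_im; apply: IHm; lia.
case: (boolP (odd m)) => [m_odd | m_even]; last first.
  have := @w_y_even m./2; rewrite (_ : m./2.*2 = m); last by lia.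
  exact.
have mE : (m.+1 = (m.+1)./2.*2)%N by lia.
have [p_m|//] := w_y_odd mE ltac:(lia) ltac:(lia) wy0.
have [m3 | m_lt3] := leqP 3 m.
  by apply: w_y_primepow => //; lia.
have -> : m = 1%N by lia.
by apply: comp2y; apply: (w_comp 1).
Qed.

(** * From the second diamond to the third *)

Hypotheses (p_q : (p %| q)%N).
Hypothesis others_infinite : forall m, (1 < m)%N -> m != q ->
  is_diamond x y m -> infinite_type x y m.

(* For [j = q - 5] every coefficient provided by [first_chain] vanishes mod [p].
   Here [g = [d x^(q-5)]] satisfies the relations [[g y y] = 0] and
   [[g x y] = -2 [g y x]], incompatible with [[g y]] nonzero. *)
Lemma d_exceptional : (forall i, (i < q - 5)%N -> liepow d x i ** y = 0) ->
  liepow d x (q - 5) ** y = 0.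
Proof.
move=> dy0; set g := liepow d x (q - 5).
have n2 := natr2_neq0 charF p_gt3; have n3 := natr3_neq0 charF p_gt3.
have gP : is_basis (component L (q.+1 + (q - 5))) [:: g].
  exact: (chain_basis thinL xyP (ltn0Sn q) d_basis dy0).
have /basis1P[gV g0 _] := gP.
have gyy : g ** y ** y = 0.
  rewrite /g (_ : q - 5 = (q - 6).+1)%N; last by lia.
  by apply: br_yy xyy _; apply: dy0; lia.
(* In [[v1 w_(q-3) y] = [v1 y w_(q-3)]] only [[g x y]] and [[g y x]] survive; since [q = 0] in the
   field it reads [3 [g x y] = -6 [g y x]]. *)
have gxy : g ** x ** y = - 2 *: (g ** y ** x).
  have := br_ad v1 (w (q - 3)) y; rewrite w_y_eq0 // br0r.
  have [v1xx v1yy v1yx] := v1_rel.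
  rewrite (@ad_w_diamond _ _ x y v1 0 (q - 3) 2) //=; try lia.
  rewrite (ad_w_vy _ v1_rel); last by lia.
  have aE : (q - 3 = (q - 5).+2)%N by lia.
  have aF : (q - 5).+2%:R = - 3%:R :> F.
    apply/eqP; rewrite -subr_eq0 opprK -natrD (natr_eq0 charF).
    by rewrite (_ : (_ + 3 = q)%N) //; lia.
  have a_odd : odd (q - 5) = false by lia.
  rewrite aE big_ord_recr big_ord_recr big1 => [|i _]; last first.
    by rewrite /= dy0 ?liepow0 ?scaler0 //; have := ltn_ord i; lia.
  rewrite /= add0r subnn subSnn bin0 bin1 binn binSn /= -/g aF.
  rewrite expr1 !exprS -signr_odd a_odd brZl scalerDr !scalerA => /esym E.
  apply: (scalerI n3); apply/eqP; rewrite -subr_eq0 -E scalerA -scaleNr.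
  have comb (a b e : F) (u v : L) :
      (a - e) *: u + - b *: v = a *: u - (b *: v + e *: u).
    by rewrite opprD addrCA scalerBl scaleNr addrC.
  by apply/eqP; rewrite -comb; congr (_ *: _ + _ *: _); ring.
(* A two-dimensional component would have infinite type, and [[g y x] = - [g x y]] together with
   [gxy] would kill both products. In the one-dimensional case [[g x]] and [[g y]] are
   proportional. *)
have [dim1 | dim2] := dim12 thinL (ltn0Sn (q.+1 + (q - 5))); last first.
  have inf : infinite_type x y (q.+1 + (q - 5)).+1.
    by apply: others_infinite; [lia | lia | apply: Or31].
  have [gxx _ gyx] := infinite_type_basis gP inf.
  have gxy0 : g ** x ** y = 0.
    move: gxy; rewrite gyx scalerA => /eqP; rewrite -subr_eq0 -{1}[_ ** y]scale1r.
    rewrite -scalerBl scaler_eq0 (_ : 1 - _ = -1); last by ring.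
    by rewrite oppr_eq0 oner_eq0 => /eqP.
  have gx0 : g ** x = 0 by apply: (alive thinL xyP _ (comp_x xyP gV)).
  apply: (alive thinL xyP _ (comp_y xyP gV)) => //.
  by rewrite gyx gxy0 scaler0.
have gyV := comp_y xyP gV; have gxV := comp_x xyP gV.
have [gx | gx] := eqVneq (g ** x) 0.
  apply: (alive thinL xyP _ gyV) => //; move/esym/eqP: gxy.
  by rewrite gx br0l scaler_eq0 oppr_eq0 (negPf n2) => /eqP.
have /basis1P[_ _ /(_ _ gyV)[a gyE]] := has_dim1_basis dim1 gxV gx.
have [a0 | a0] := eqVneq a 0; first by rewrite gyE a0 scale0r.
have gxy0 : g ** x ** y = 0.
  by apply: (scalerI a0); rewrite -brZl -gyE gyy scaler0.
case/negP: gx; apply/eqP/(alive thinL xyP _ gxV) => //.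
apply: (scalerI a0); rewrite -brZl -gyE scaler0.
move/esym/eqP: gxy; rewrite gxy0 scaler_eq0 oppr_eq0 (negPf n2).
by move/eqP.
Qed.

(** With [m = q - 2] the side conditions of [first_chain] fail only at [j = q - 5]: for odd [j] the
    boundary value [q - 4] would make [p] divide 3. *)
Lemma d_chain j : (j <= q - 4)%N -> liepow d x j ** y = 0.
Proof.
elim/ltn_ind: j => j IHj le_jq.
have dy0 i : (i < j)%N -> liepow d x i ** y = 0 by move=> lt_ij; apply: IHj; lia.
have [jE | jE] := eqVneq j (q - 5)%N.
  by rewrite jE; apply: d_exceptional; rewrite -jE.
apply: (first_chain (m := (q - 2)%N)) => //; try lia.
- by move=> i lt_iq; apply: w_y_eq0; lia.
- move=> j_odd p_j; rewrite ltnNge; apply/negP=> le_qj.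
  have : (p %| q - j.+1)%N by rewrite dvdn_sub.
  by rewrite (_ : q - j.+1 = 3)%N ?gtnNdvd //; lia.
Qed.

(** * Induction along the diamonds of infinite type *)

Variable h : nat.
Local Notation dtype := (dtype F).
Hypothesis q_pow : q = (p ^ h)%N.

(* [rung j] corresponds to [t^(q-1) s^j] in the model. *)
Fixpoint rung k : L :=
  if k is k'.+1 then - (dtype k')^-1 *: (liepow (rung k') x (q - 2) ** y) else y.

Local Notation v k := (liepow (rung k) x (q - 2)).

Lemma dtype_neq0 k : dtype k != 0.
Proof. by case: k => [|k]; rewrite /= ?oner_eq0 ?(natr2_neq0 charF). Qed.

(** With parameter 1 the coefficients of [chain_relation0] are [j + 1] for odd and [j + 3] for even
    [j], and that of [chain_relation] is the single binomial [C(j+s+2, s+1)]. All of [[u x^i y] = 0]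
    is now available, so [s] can be as large as the [p]-part of [j + 3] requires. *)
Lemma later_chain u j : let v := liepow u x (q - 2) in let d := v ** x ** y in
  (forall i, (i <= q - 3)%N -> liepow u x i ** y = 0) ->
  diamond_relations x y 1 v -> (j <= q - 4)%N -> liepow d x j ** y = 0.
Proof.
move=> v d uy0 v_rel; elim/ltn_ind: j => j IHj le_jq.
have [vxx vyy vyx] := v_rel; have n2 := natr2_neq0 charF p_gt3.
have p_prime := pcharf_prime charF.
have dy0 i : (i < j)%N -> liepow d x i ** y = 0 by move=> lt_ij; apply: IHj; lia.
have rel s : (0 < s)%N -> (j + s.+1 <= q - 3)%N ->
    'C((j + s.+1).+1, s.+1)%:R != 0 :> F -> liepow d x j ** y = 0.
  move=> s_gt0 le_js nz.
  have vE : liepow (liepow u x (q - 2 - s)) x s = v by rewrite liepowD subnKC //; lia.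
  have := @chain_relation _ _ x y (liepow u x (q - 2 - s)) s (j + s.+1) 1.
  rewrite vE addnK mul1r => E; apply/eqP; rewrite binS natrD addrC in nz.
  have uyx i : (i < s)%N ->
      liepow (liepow (liepow u x (q - 2 - s)) x i ** y) x (j + s.+1 - i) = 0.
    by move=> lt_is; rewrite liepowD uy0 ?liepow0 //; lia.
  have := E vxx vyx ltac:(lia) uyx (uy0 (q - 2 - s)%N ltac:(lia)) (w_y_eq0 le_js).
  by move/eqP; rewrite scaler_eq0 (negPf nz).
have wj1 : w j.+1 ** y = 0 by apply: w_y_eq0; lia.
have := chain_relation0 (ltn0Sn j) v_rel wj1 dy0.
rewrite /= -signr_odd /=; case: (boolP (odd j)) => [j_odd | j_even] /=.
  rewrite expr0 mulr1 addrK => /eqP; rewrite scaler_eq0 (natr_eq0 charF).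
  case/orP=> [p_j | /eqP//]; have lt_jq : (j + 2 <= q - 3)%N.
    rewrite leqNgt; apply/negP=> le_qj.
    have : (p %| q - j.+1)%N by rewrite dvdn_sub.
    by rewrite (_ : q - j.+1 = 3)%N ?gtnNdvd //; lia.
  apply: (rel 1%N) => //; have jE : j%:R = -1 :> F.
    by apply/eqP; rewrite -subr_eq0 opprK natr1 (natr_eq0 charF).
  have E : 2 * 'C((j + 2).+1, 2)%:R = 2 :> F.
    by rewrite natr_bin2 -natr1 natrD jE; ring.
  by apply: contraNneq n2 => eq0; rewrite -E eq0 mulr0.
rewrite expr1 (_ : _ - _ = (j + 3)%:R); last by rewrite -natr1 natrD; ring.
move/eqP; rewrite scaler_eq0 (natr_eq0 charF) => /orP[p_j | /eqP//].
have j3_gt0 : (0 < j + 3)%N by lia.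
have [n co_pn jE] := pfactor_coprime p_prime j3_gt0.
set e := logn p (j + 3) in jE.
have e_gt0 : (0 < e)%N by rewrite logn_gt0 mem_primes p_prime j3_gt0.
have r_gt3 : (3 < p ^ e)%N.
  by apply: leq_trans p_gt3 _; rewrite -{1}(expn1 p) leq_exp2l //; lia.
have n_gt0 : (0 < n)%N by case: n jE {co_pn} => //; lia.
have lt_eh : (e < h)%N.
  rewrite -(ltn_exp2l _ _ (prime_gt1 p_prime)) -q_pow.
  have : (p ^ e <= j + 3)%N by rewrite jE leq_pmull.
  by lia.
have r_q : (p ^ e %| q - (j + 3))%N.
  by rewrite dvdn_sub // ?q_pow ?dvdn_exp2l ?jE ?dvdn_mull // ltnW.
have le_r : (p ^ e <= q - (j + 3))%N by apply: dvdn_leq r_q; lia.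
(* With [r] the [p]-part of [j + 3 = r n] and [s = r - 1] the binomial is [C(r n + r - 2, r) = n].
   The index [j + r] is at most [q - 3] because [r] divides the positive number [q - (j + 3)]; here
   [q] must be a power of [p]. *)
apply: (rel (p ^ e).-1); rewrite ?prednK; try lia.
rewrite (_ : (_ + _).+1 = p ^ e * n + (p ^ e - 2))%N; last by rewrite mulnC -jE; lia.
rewrite (bin_primepow_top charF); last by lia.
by rewrite (natr_eq0 charF) -prime_coprime.
Qed.

(** Expand [[u w_q] = 0]: the inner binomials [C(q, i)] vanish modulo [p] and the last term contains
    [[u x^q]]. Applied just before a diamond, this gives [[v x x] = 0] for the [v] just before the
    next one. *)
Lemma liepow_vy_q u : u ** x ** x = 0 -> liepow (u ** y) x q = 0.
Proof.
move=> uxx; have := ad_liepow u x y q; rewrite w_eq0 // br0r.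
rewrite big_ord_recl bin0 mulr1 scale1r subn0 => /esym.
rewrite big1 ?addr0 // => i _; rewrite lift0.
have [->|ne_iq] := eqVneq i.+1 q.
  by rewrite (@liepow_eq0 _ _ u x 2) ?br0l ?liepow0 ?scaler0 //; lia.
rewrite (bin_primepow charF q_pow) ?mulr0 ?scale0r //.
by have := ltn_ord i; lia.
Qed.

Definition rung_spec k : Prop :=
  [/\ diamond_relations x y (dtype k) (v k),
      forall i, (i <= q - 3)%N -> liepow (rung k) x i ** y = 0,
      is_basis (component L (k.+1 * (q - 1))) [:: v k]
    & has_dim (component L (k.+1 * (q - 1)).+1) 2].

Lemma rung_spec0 : rung_spec 0.
Proof.
split; rewrite ?mul1n ?q_pred //; exact: w_y_eq0.
Qed.

(** The scalar in [rung] is chosen for this identity: the chain starting at the new rung then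
    continues along the powers of [x] applied to [[v x y]]. *)
Lemma rungS_x k : rung_spec k -> rung k.+1 ** x = v k ** x ** y.
Proof.
case=> [[_ _ vyx] _ _ _]; rewrite /= brZl vyx scalerA mulrNN.
by rewrite mulVf ?dtype_neq0 // scale1r.
Qed.

Lemma rung_specS k : rung_spec k -> rung_spec k.+1.
Proof.
move=> spec; have [v_rel uy0 vP dim2] := spec; have [vxx vyy vyx] := v_rel.
have n_gt0 : (0 < k.+1 * (q - 1))%N by rewrite muln_gt0; lia.
have dP := diamond_bottom thinL xyP n_gt0 vP dim2 vxx.
have dy0 j : (j <= q - 4)%N -> liepow (v k ** x ** y) x j ** y = 0.
  move=> le_jq; case: k {spec vP dim2 n_gt0 dP vxx vyy vyx} v_rel uy0 => [|k] v_rel uy0.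
    exact: d_chain.
  exact: later_chain uy0 v_rel le_jq.
have uE i : liepow (rung k.+1) x i.+1 = liepow (v k ** x ** y) x i.
  by rewrite liepowSr rungS_x.
have u'y0 i : (i <= q - 3)%N -> liepow (rung k.+1) x i ** y = 0.
  case: i => [|i] le_iq; first by rewrite /= brZl vyy scaler0.
  by rewrite uE dy0 //; lia.
have vE : v k.+1 = liepow (v k ** x ** y) x (q - 3) by rewrite -uE; congr liepow; lia.
have v'P : is_basis (component L (k.+2 * (q - 1))) [:: v k.+1].
  have := chain_basis thinL xyP (i := (q - 3)%N) (ltn0Sn _) dP _.
  rewrite vE (_ : (_ + (q - 3) = k.+2 * (q - 1))%N); last by lia.
  by apply=> j lt_jq; apply: dy0; lia.
have /basis1P[v'V v'0 _] := v'P.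
have v'xx : v k.+1 ** x ** x = 0.
  rewrite -2!liepowS (_ : (q - 2).+2 = q); last by lia.
  by rewrite liepowZ liepow_vy_q ?scaler0.
have v'yy : v k.+1 ** y ** y = 0.
  rewrite (_ : (q - 2 = (q - 3).+1)%N); last by lia.
  by apply: br_yy xyy _; apply: u'y0.
have n'_gt0 : (1 < (k.+2 * (q - 1)).+1)%N by rewrite mulSn; lia.
have n'_q : (k.+2 * (q - 1)).+1 != q by rewrite mulSn; lia.
have dim2' : has_dim (component L (k.+2 * (q - 1)).+1) 2.
  have [dim1 | //] := dim12 thinL (ltnW n'_gt0).
  have v'xV := comp_x xyP v'V; have v'yV := comp_y xyP v'V.
  suff : is_diamond x y (k.+2 * (q - 1)).+1.
    by move/(others_infinite n'_gt0 n'_q) => [].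
  have [v'x | v'x] := eqVneq (v k.+1 ** x) 0.
    by apply: Or33; split=> //; exists (v k.+1).
  apply: Or32; split=> //; exists (v k.+1); split=> //.
  (* If [[v' y]] were a nonzero multiple of [[v' x]], then [[v' y y] = 0] would give [[v' x y] = 0],
     and with [[v' x x] = 0] this contradicts covering. *)
  have /basis1P[_ _ /(_ _ v'yV)[a v'yE]] := has_dim1_basis dim1 v'xV v'x.
  have [a0 | a0] := eqVneq a 0; first by rewrite v'yE a0 scale0r.
  case/negP: v'x; apply/eqP/(alive thinL xyP _ v'xV) => //.
  by apply: (scalerI a0); rewrite -brZl -v'yE v'yy scaler0.
split=> //; apply: (infinite_type_basis v'P).
by apply: others_infinite => //; apply: Or31.
Qed.

Lemma rungP k : rung_spec k.
Proof. by elim: k => [|k]; [apply: rung_spec0 | apply: rung_specS]. Qed.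

End FirstChain.

(** * The model *)

Section HurwitzProduct.
Variable A : comNzRingType.
Implicit Types f g : nat -> A.

(* The product of divided power series, computed by the Leibniz rule since the
   derivation is the shift of coefficients. *)
Fixpoint hmul f g n : A :=
  if n is n'.+1 then hmul (fun k => f k.+1) g n' + hmul f (fun k => g k.+1) n'
  else f 0%N * g 0%N.

Lemma eq_hmul f f' g g' n :
  (forall k, (k <= n)%N -> f k = f' k) -> (forall k, (k <= n)%N -> g k = g' k) ->
  hmul f g n = hmul f' g' n.
Proof.
elim: n f f' g g' => [|n IHn] f f' g g' eq_f eq_g /=; first by rewrite eq_f ?eq_g.
by congr (_ + _); apply: IHn => k le_kn; rewrite ?eq_f ?eq_g // ltnW.
Qed.

Lemma hmulC f g n : hmul f g n = hmul g f n.
Proof.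
elim: n f g => [|n IHn] f g /=; first by rewrite mulrC.
by rewrite addrC; congr (_ + _); apply: IHn.
Qed.

Lemma hmulDl f f' g n : hmul (fun k => f k + f' k) g n = hmul f g n + hmul f' g n.
Proof.
elim: n f f' g => [|n IHn] f f' g /=; first by rewrite mulrDl.
by rewrite !IHn addrACA.
Qed.

Lemma hmulDr f g g' n : hmul f (fun k => g k + g' k) n = hmul f g n + hmul f g' n.
Proof. by rewrite hmulC hmulDl !(hmulC f). Qed.

Lemma hmul0l g n : hmul (fun=> 0) g n = 0.
Proof. by elim: n g => [|n IHn] g /=; rewrite ?mul0r // !IHn addr0. Qed.

Lemma hmul1l g n : hmul (fun k => (k == 0)%:R) g n = g n.
Proof.
elim: n g => [|n IHn] g /=; first by rewrite mul1r.
by rewrite hmul0l add0r IHn.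
Qed.

Lemma hmulA f g k n : hmul f (hmul g k) n = hmul (hmul f g) k n.
Proof.
elim: n f g k => [|n IHn] f g k /=; first by rewrite mulrA.
by rewrite hmulDl hmulDr !IHn addrA.
Qed.

Lemma hmulE f g n : hmul f g n = \sum_(i < n.+1) 'C(n, i)%:R * (f i * g (n - i)%N).
Proof.
elim: n f g => [|n IHn] f g; first by rewrite big_ord1 bin0 mul1r.
rewrite [LHS]/= !IHn addrC.
transitivity (\sum_(i < n.+2) 'C(n, i)%:R * (f i * g (n.+1 - i)%N) +
  \sum_(i < n.+1) 'C(n, i)%:R * (f i.+1 * g (n - i)%N)).
  congr (_ + _); rewrite [in RHS]big_ord_recr /= (@bin_small n n.+1) // mul0r addr0.
  by apply: eq_bigr => i _; rewrite subSn // -ltnS.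
rewrite big_ord_recl [in RHS]big_ord_recl -addrA !bin0; congr (_ + _).
rewrite -big_split; apply: eq_bigr => i _.
by rewrite lift0 subSS binS natrD mulrDl.
Qed.

Lemma hmul_delta f m n :
  hmul f (fun k => (k == m)%:R) n = if (m <= n)%N then 'C(n, m)%:R * f (n - m)%N else 0.
Proof.
rewrite hmulE; case: leqP => [le_mn | lt_nm].
  rewrite (bigD1 (inord (n - m))) //= inordK ?ltnS ?leq_subr // big1 ?addr0 => [|i ne_i].
    by rewrite bin_sub // subKn // eqxx mulr1.
  case: eqP => [eq_m|]; last by rewrite !mulr0.
  case/eqP: ne_i; apply: val_inj; rewrite /= inordK ?ltnS ?leq_subr //.
  by have := ltn_ord i; lia.
by rewrite big1 // => i _; rewrite [_ == m](_ : _ = false) ?mulr0 //; lia.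
Qed.
End HurwitzProduct.

(** * Truncated divided powers over F[s] *)

Section DividedPowers.
Variables (F : fieldType) (N : nat).
Implicit Types (j k : nat).

(* [O[s]] for [q = N.+1]: the value at [i] is the coefficient of [t^(i)], a
   polynomial in [s].  Coefficients beyond [N] are dropped by the product; [d/dt]
   is a derivation only because [q] is a power of the characteristic. *)
Definition divpow : Type := {ffun 'I_N.+1 -> {poly F}}.
HB.instance Definition _ := GRing.Lmodule.on divpow.
Implicit Types f g : divpow.

Definition dp_coef f k : {poly F} := if (k <= N)%N then f (inord k) else 0.
Definition dp_of (c : nat -> {poly F}) : divpow := [ffun i => c (val i)].

Lemma dp_coef_ord f (i : 'I_N.+1) : dp_coef f i = f i.
Proof. by rewrite /dp_coef -ltnS ltn_ord inord_val. Qed.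

Lemma dp_coef_of c k : (k <= N)%N -> dp_coef (dp_of c) k = c k.
Proof. by move=> le_kN; rewrite /dp_coef le_kN ffunE /= inordK. Qed.

Lemma dp_coef_out f k : (N < k)%N -> dp_coef f k = 0.
Proof. by rewrite /dp_coef ltnNge => /negPf->. Qed.

Lemma dp_eq f g : (forall k, (k <= N)%N -> dp_coef f k = dp_coef g k) -> f = g.
Proof.
by move=> eq_fg; apply/ffunP => i; rewrite -!dp_coef_ord eq_fg // -ltnS.
Qed.

Lemma dp_coefD f g k : dp_coef (f + g) k = dp_coef f k + dp_coef g k.
Proof. by rewrite /dp_coef; case: ifP => _; rewrite ?ffunE ?addr0. Qed.

Lemma dp_coefN f k : dp_coef (- f) k = - dp_coef f k.
Proof. by rewrite /dp_coef; case: ifP => _; rewrite ?ffunE ?oppr0. Qed.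

Lemma dp_coefZ a f k : dp_coef (a *: f) k = a *: dp_coef f k.
Proof. by rewrite /dp_coef; case: ifP => _; rewrite ?ffunE ?scaler0. Qed.

Lemma dp_coef0 k : dp_coef 0 k = 0.
Proof. by rewrite /dp_coef; case: ifP => _; rewrite ?ffunE. Qed.

Definition dp_mul f g : divpow := dp_of (hmul (dp_coef f) (dp_coef g)).
Definition dp_one : divpow := dp_of (fun k => (k == 0)%:R).

Lemma dp_coef_mul f g k : (k <= N)%N ->
  dp_coef (dp_mul f g) k = hmul (dp_coef f) (dp_coef g) k.
Proof. exact: dp_coef_of. Qed.

Lemma dp_mulA : associative dp_mul.
Proof.
move=> f g e; apply: dp_eq => k le_kN; rewrite !dp_coef_mul //.
transitivity (hmul (dp_coef f) (hmul (dp_coef g) (dp_coef e)) k).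
  by apply: eq_hmul => // i le_ik; rewrite dp_coef_mul // (leq_trans le_ik).
rewrite hmulA; apply: eq_hmul => // i le_ik.
by rewrite dp_coef_mul // (leq_trans le_ik).
Qed.

Lemma dp_mulC : commutative dp_mul.
Proof. by move=> f g; apply: dp_eq => k le_kN; rewrite !dp_coef_mul // hmulC. Qed.

Lemma dp_mul1 : left_id dp_one dp_mul.
Proof.
move=> f; apply: dp_eq => k le_kN; rewrite dp_coef_mul // -[RHS]hmul1l.
by apply: eq_hmul => // i le_ik; rewrite dp_coef_of // (leq_trans le_ik).
Qed.

Lemma dp_mulDl : left_distributive dp_mul +%R.
Proof.
move=> f g e; apply: dp_eq => k le_kN; rewrite dp_coefD !dp_coef_mul // -hmulDl.
by apply: eq_hmul => // i _; rewrite dp_coefD.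
Qed.

Lemma dp_one_neq0 : dp_one != 0.
Proof.
apply/eqP=> /ffunP/(_ ord0); rewrite !ffunE /= => /eqP.
by rewrite oner_eq0.
Qed.

HB.instance Definition _ :=
  GRing.Zmodule_isComNzRing.Build divpow dp_mulA dp_mulC dp_mul1 dp_mulDl dp_one_neq0.

Lemma dp_mulE f g k : (k <= N)%N ->
  dp_coef (f * g) k = hmul (dp_coef f) (dp_coef g) k.
Proof. exact: dp_coef_mul. Qed.

Lemma dp_scalerAl a f g : a *: (f * g) = a *: f * g.
Proof.
apply: dp_eq => k le_kN; rewrite dp_coefZ !dp_mulE // !hmulE scaler_sumr.
by apply: eq_bigr => i _; rewrite dp_coefZ -scalerAl scalerAr.
Qed.

Definition dp_der f : divpow := dp_of (fun k => dp_coef f k.+1).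

Lemma dp_coef_der f k : dp_coef (dp_der f) k = dp_coef f k.+1.
Proof.
case: (leqP k N) => [le_kN | lt_Nk]; first exact: dp_coef_of.
by rewrite !dp_coef_out // ltnW.
Qed.

Lemma dp_der_is_linear : linear dp_der.
Proof.
by move=> a f g; apply: dp_eq => k _; rewrite !(dp_coef_der, dp_coefD, dp_coefZ).
Qed.
HB.instance Definition _ :=
  GRing.isLinear.Build F divpow divpow _ dp_der dp_der_is_linear.

Definition dp_const f : divpow := [ffun i => ((f i)`_0)%:P].

Lemma dp_coef_const f k : dp_coef (dp_const f) k = ((dp_coef f k)`_0)%:P.
Proof. by rewrite /dp_coef; case: ifP => _; rewrite ?ffunE // coef0. Qed.

Lemma dp_const_is_linear : linear dp_const.
Proof.
move=> a f g; apply: dp_eq => k _.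
rewrite !(dp_coef_const, dp_coefD, dp_coefZ) coefD coefZ polyCD.
by rewrite -mul_polyC polyCM mul_polyC.
Qed.
HB.instance Definition _ :=
  GRing.isLinear.Build F divpow divpow _ dp_const dp_const_is_linear.

Lemma dp_const_mul f g : dp_const (f * g) = dp_const f * dp_const g.
Proof.
apply: dp_eq => k le_kN; rewrite dp_coef_const !dp_mulE // !hmulE coef_sum rmorph_sum /=.
apply: eq_bigr => i _; rewrite !dp_coef_const !coef0M !polyCM.
by rewrite -polyC_natr coefC.
Qed.

Lemma dp_const_der f : dp_const (dp_der f) = dp_der (dp_const f).
Proof. by apply: dp_eq => k _; rewrite !(dp_coef_der, dp_coef_const). Qed.

Definition dp_s : divpow := dp_of (fun k => (k == 0)%:R * 'X).

Lemma dp_coef_sM f k : dp_coef (dp_s * f) k = 'X * dp_coef f k.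
Proof.
case: (leqP k N) => [le_kN | lt_Nk]; last by rewrite !dp_coef_out // mulr0.
rewrite dp_mulE // hmulE big_ord_recl big1 => [|i _].
  by rewrite addr0 bin0 mul1r subn0 dp_coef_of // eqxx mul1r.
rewrite lift0 dp_coef_of ?mul0r ?mulr0 //.
by have := ltn_ord i; lia.
Qed.

Lemma dp_const_s : dp_const dp_s = 0.
Proof.
apply: dp_eq => k le_kN; rewrite dp_coef_const dp_coef0 dp_coef_of //.
by rewrite coefMX.
Qed.

(** * The Lie bracket and the grading of the model *)

Section Derivation.
Variables (p h : nat).
Hypotheses (charF : p \in [pchar F]) (N_primepow : N.+1 = (p ^ h)%N).

Lemma dp_derM f g : dp_der (f * g) = dp_der f * g + f * dp_der g.
Proof.
apply: dp_eq => k le_kN; rewrite dp_coef_der dp_coefD.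
rewrite (dp_mulE (dp_der f)) // (dp_mulE f (dp_der g)) //.
transitivity (hmul (dp_coef f) (dp_coef g) k.+1); last first.
  by congr (_ + _); apply: eq_hmul => // i _; rewrite dp_coef_der.
case: (ltngtP k N) le_kN => // [lt_kN | ->] _; first by rewrite dp_mulE.
(* In degree [N] the derivative reads the coefficient [q] that truncation drops. The untruncated one
   is zero as well: its end terms are out of range and [C(q, i) = 0] for [0 < i < q]. *)
rewrite dp_coef_out // hmulE big1 // => i _.
have [i0 | i_gt0] := posnP i.
  by rewrite i0 subn0 (@dp_coef_out g) // !mulr0.
have [iN | lt_iN] := eqVneq (i : nat) N.+1.
  by rewrite iN (@dp_coef_out f) // mul0r mulr0.
rewrite -polyC_natr (bin_primepow charF N_primepow) ?mul0r //.
by have := ltn_ord i; lia.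
Qed.

Lemma dp_der_s : dp_der dp_s = 0.
Proof.
apply: dp_eq => k le_kN; rewrite dp_coef_der dp_coef0.
case: (ltngtP k N) le_kN => // [lt_kN | ->] _; last by rewrite dp_coef_out.
by rewrite dp_coef_of // mul0r.
Qed.

Definition model_carrier : Type := (F^o * divpow)%type.
HB.instance Definition _ := GRing.Lmodule.on model_carrier.
Implicit Types u v w : model_carrier.

Definition model_bracket u v : model_carrier :=
  (0, v.1 *: dp_der u.2 - u.1 *: dp_der v.2 +
      dp_s * (u.2 * dp_const (dp_der v.2) - v.2 * dp_const (dp_der u.2))).

(** Turns scaling into a product, so that bracket identities come within reach of [ring]. *)
Definition dp_scalar (a : F) : divpow := a *: (1 : divpow).

Lemma dp_scaleE a f : a *: f = dp_scalar a * f.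
Proof. by rewrite -dp_scalerAl mul1r. Qed.

Lemma model_eq u v : u.1 = v.1 -> u.2 = v.2 -> u = v.
Proof. by case: u v => [? ?] [? ?] /= -> ->. Qed.

Lemma model_bracketC u v : model_bracket u v = - model_bracket v u.
Proof.
apply: model_eq; first by rewrite /= oppr0.
rewrite /= !(dp_scaleE u.1) !(dp_scaleE v.1); ring.
Qed.

Lemma model_bracket_linear u : linear (model_bracket u).
Proof.
move=> a v w; apply: model_eq; first by rewrite /= scaler0 addr0.
rewrite /= !linearP /= scalerDl !(dp_scaleE a) !(dp_scaleE u.1).
rewrite -scalerA !(dp_scaleE a) !(dp_scaleE v.1) !(dp_scaleE w.1); ring.
Qed.

Lemma model_bracket_bilinear : bilinear_for *:%R *:%R model_bracket.
Proof.
split=> u; last exact: model_bracket_linear.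
move=> a v w /=; rewrite (model_bracketC (_ + _)) model_bracket_linear opprD -scalerN.
by rewrite -!model_bracketC.
Qed.
HB.instance Definition _ :=
  bilinear_isBilinear.Build F model_carrier model_carrier model_carrier *:%R *:%R
    model_bracket model_bracket_bilinear.

Lemma model_bracketxx u : model_bracket u u = 0.
Proof. by apply: model_eq => //=; rewrite !subrr mulr0 addr0. Qed.

Lemma dp_derD f g : dp_der (f + g) = dp_der f + dp_der g.
Proof. exact: linearD. Qed.
Lemma dp_derB f g : dp_der (f - g) = dp_der f - dp_der g.
Proof. exact: linearB. Qed.
Lemma dp_derZ a f : dp_der (a *: f) = a *: dp_der f.
Proof. exact: linearZ. Qed.
Lemma dp_constD f g : dp_const (f + g) = dp_const f + dp_const g.
Proof. exact: linearD. Qed.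
Lemma dp_constB f g : dp_const (f - g) = dp_const f - dp_const g.
Proof. exact: linearB. Qed.
Lemma dp_constZ a f : dp_const (a *: f) = a *: dp_const f.
Proof. exact: linearZ. Qed.
Lemma dp_der_sM f : dp_der (dp_s * f) = dp_s * dp_der f.
Proof. by rewrite dp_derM dp_der_s mul0r add0r. Qed.
Lemma dp_const_sM f : dp_const (dp_s * f) = 0.
Proof. by rewrite dp_const_mul dp_const_s mul0r. Qed.

(** The part of the inner bracket that is divisible by [s] disappears from the factor of [e]. What
    remains is polynomial in [f], [g], [e] and their images under [D] and [Z], and its cyclic sum
    cancels formally. *)
Lemma model_bracket_bracket u v w :
  (model_bracket (model_bracket u v) w).2 =
  let: ((a, f), (b, g), (c, e)) := (u, v, w) in
  let D := dp_der in let Z t := dp_const (dp_der t) in let K := dp_scalar in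
  K c * (K b * D (D f) - K a * D (D g)
         + dp_s * (D f * Z g + f * Z (D g) - (D g * Z f + g * Z (D f))))
  + dp_s * ((K b * D f - K a * D g + dp_s * (f * Z g - g * Z f)) * Z e
            - e * (K b * Z (D f) - K a * Z (D g))).
Proof.
case: u v w => [a f] [b g] [c e]; rewrite /model_bracket [LHS]/= scale0r subr0.
rewrite dp_derD dp_derB !dp_derZ dp_der_sM dp_derB !dp_derM -!dp_const_der.
rewrite dp_constD dp_const_sM addr0 dp_constB !dp_constZ.
by rewrite !(dp_scaleE a) !(dp_scaleE b) !(dp_scaleE c).
Qed.

Lemma model_jacobi u v w :
  model_bracket (model_bracket u v) w + model_bracket (model_bracket v w) u
    + model_bracket (model_bracket w u) v = 0.
Proof.
have z3 : (0 + 0 + 0 : F) = 0 by rewrite !addr0.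
apply: model_eq; first exact: z3.

change ((model_bracket (model_bracket u v) w).2 +
  (model_bracket (model_bracket v w) u).2 + (model_bracket (model_bracket w u) v).2 = 0).
have add3 (A B C A' B' C' : divpow) :
  A = A' -> B = B' -> C = C' -> A' + B' + C' = 0 -> A + B + C = 0 by move=> -> -> ->.
apply: (add3 _ _ _ _ _ _ (model_bracket_bracket u v w)
  (model_bracket_bracket v w u) (model_bracket_bracket w u v)).
case: u v w => [a f] [b g] [c e]; lazy zeta iota; ring.
Qed.

(* The degree of [t^(k) s^j]. *)
Definition dp_deg k j : nat := (j * N + (N.+1 - k))%N.

(** To be boolean, the condition runs only over powers of [s] below the size of each coefficient;
    beyond it everything is zero. *)
Definition model_component n : {pred model_carrier} :=
  fun u => ((n == 1%N) || (u.1 == 0)) && [forall i : 'I_N.+1,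
    all (fun j => (dp_deg i j == n) || ((u.2 i)`_j == 0)) (iota 0 (size (u.2 i)))].

Lemma model_componentP n u : (u \in model_component n) <->
  (n != 1%N -> u.1 = 0) /\
  forall k j, (k <= N)%N -> dp_deg k j != n -> (dp_coef u.2 k)`_j = 0.
Proof.
split=> [/andP[u1 /forallP uP] | [u1 uP]].
  split=> [/negPf n1|k j le_kN /negPf neq]; first by move: u1; rewrite n1 => /eqP.
  rewrite /dp_coef le_kN; have /allP/(_ j) := uP (inord k).
  rewrite mem_iota /= inordK // neq /= add0n.
  by case: ltnP => [_ /(_ isT)/eqP | /(nth_default 0)->].
apply/andP; split; first by case: eqP => //= /eqP/u1/eqP.
apply/forallP=> i; apply/allP=> j _; case: eqP => //= /eqP neq.
by rewrite -dp_coef_ord uP // -ltnS.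
Qed.

Lemma model_eqP u v : u.1 = v.1 ->
  (forall k j, (k <= N)%N -> (dp_coef u.2 k)`_j = (dp_coef v.2 k)`_j) -> u = v.
Proof.
move=> eq1 eq2; apply: model_eq => //; apply: dp_eq => k le_kN.
by apply/polyP => j; apply: eq2.
Qed.

Lemma model_component_submod n : submod_closed (model_component n).
Proof.
split=> [|a u v /model_componentP[u1 u2] /model_componentP[v1 v2]].
  by apply/model_componentP; split=> [//|k j _ _]; rewrite /= dp_coef0 coef0.
apply/model_componentP; split=> [n1|k j le_kN neq] /=.
  by rewrite u1 // v1 // scaler0 addr0.
by rewrite dp_coefD dp_coefZ coefD coefZ u2 // v2 // mulr0 addr0.
Qed.

Lemma model_component0 : model_component 0 =i pred1 0.
Proof.
move=> u; rewrite inE; apply/idP/eqP => [/model_componentP[u1 u2] | ->].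
  apply: model_eqP => [|k j le_kN]; first exact: u1.
  by rewrite u2 ?dp_coef0 ?coef0 // /dp_deg; lia.
by have [] := model_component_submod 0.
Qed.

(** The degree condition freed from subtraction: for [a = N + 1] it means support in degree [b].
    Both offsets add under products, and [d/dt] raises [b] by one. *)
Definition homogeneous (a b : nat) (c : nat -> {poly F}) : Prop :=
  forall k j, (j * N + a)%N != (k + b)%N -> (c k)`_j = 0.

Lemma homogeneous_ext a b c c' : c =1 c' -> homogeneous a b c -> homogeneous a b c'.
Proof. by move=> eq_c hom k j neq; rewrite -eq_c hom. Qed.

Lemma homogeneous_shift a b c : homogeneous a b c ->
  homogeneous a b.+1 (fun k => c k.+1).
Proof. by move=> hc k j neq; apply: hc; lia. Qed.

Lemma homogeneous_hmul a b a' b' c c' : homogeneous a b c -> homogeneous a' b' c' ->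
  homogeneous (a + a') (b + b') (hmul c c').
Proof.
move=> hc hc' k; elim: k b b' c c' hc hc' => [|k IHk] b b' c c' hc hc' j neq /=.
  rewrite coefM big1 // => i _.
  have [eq_i | neq_i] := eqVneq (i * N + a)%N (0 + b)%N; last by rewrite hc ?mul0r.
  rewrite (hc' _ (j - i)%N) ?mulr0 //.
  apply: contra_neq neq => eq_ji; rewrite mulnBl in eq_ji.
  have : (i * N <= j * N)%N by rewrite leq_mul2r -ltnS ltn_ord orbT.
  by lia.
rewrite coefD (IHk b.+1 b') ?(IHk b b'.+1) ?addr0 //; try exact: homogeneous_shift; lia.
Qed.

Lemma model_component_hom n u :
  u \in model_component n -> homogeneous N.+1 n (dp_coef u.2).
Proof.
case/model_componentP=> _ uP k j neq; case: (leqP k N) => [le_kN | lt_Nk].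
  by apply: uP => //; rewrite /dp_deg; lia.
by rewrite dp_coef_out // coef0.
Qed.

Lemma homogeneous_der a b f :
  homogeneous a b (dp_coef f) -> homogeneous a b.+1 (dp_coef (dp_der f)).
Proof.
by move=> /homogeneous_shift; apply: homogeneous_ext => k; rewrite dp_coef_der.
Qed.

Lemma homogeneous_const a b f :
  homogeneous a b (dp_coef f) -> homogeneous a b (dp_coef (dp_const f)).
Proof.
move=> hf k j neq; rewrite dp_coef_const coefC; case: eqP => // j0.
by rewrite hf //; rewrite j0 in neq.
Qed.

Lemma homogeneous_mul a b a' b' f g :
  homogeneous a b (dp_coef f) -> homogeneous a' b' (dp_coef g) ->
  homogeneous (a + a') (b + b') (dp_coef (f * g)).
Proof.
move=> hf hg k j neq; case: (leqP k N) => [le_kN | lt_Nk].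
  by rewrite dp_mulE //; apply: homogeneous_hmul neq.
by rewrite dp_coef_out // coef0.
Qed.

Lemma model_component_bracket m n u v :
  u \in model_component m -> v \in model_component n ->
  model_bracket u v \in model_component (m + n).
Proof.
move=> uP vP; have [u1 _] := (model_componentP m u).1 uP.
have [v1 _] := (model_componentP n v).1 vP.
have hu := model_component_hom uP; have hv := model_component_hom vP.
apply/model_componentP; split=> // k j le_kN neq.
have neq1 : (j * N + N.+1 != k + (m + n))%N by move: neq; rewrite /dp_deg; lia.
rewrite /= dp_coefD dp_coefD dp_coefN !dp_coefZ dp_coef_sM coefD coefB !coefZ.
have -> : v.1 * (dp_coef (dp_der u.2) k)`_j = 0.
  have [n1 | n1] := eqVneq n 1%N; last by rewrite v1 ?mul0r.
  by rewrite (homogeneous_der hu) ?mulr0 //; lia.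
have -> : u.1 * (dp_coef (dp_der v.2) k)`_j = 0.
  have [m1 | m1] := eqVneq m 1%N; last by rewrite u1 ?mul0r.
  by rewrite (homogeneous_der hv) ?mulr0 //; lia.
have hD f a b (hf : homogeneous a b (dp_coef f)) :=
  homogeneous_const (homogeneous_der hf).
rewrite subrr add0r coefXM; case: eqP => // /eqP j0.
rewrite dp_coefD dp_coefN coefB.
(* The factor [s] lowers the exponent by one, which absorbs the second offset [N + 1] and the
   derivative: [(j-1) N + 2 (N+1) = k + m + n + 1] is the degree condition for [m + n]. *)
have h1 := homogeneous_mul hu (hD _ _ _ hv); have h2 := homogeneous_mul hv (hD _ _ _ hu).
by rewrite h1 ?h2 ?subrr //; case: j j0 {neq} neq1 => // j _ /=; lia.
Qed.

Definition model_proj n u : model_carrier :=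
  (if n == 1%N then u.1 else 0,
   [ffun i => \poly_(j < size (u.2 i)) (if dp_deg i j == n then (u.2 i)`_j else 0)]).

Lemma dp_coef_proj n u k j : (k <= N)%N ->
  (dp_coef (model_proj n u).2 k)`_j = if dp_deg k j == n then (dp_coef u.2 k)`_j else 0.
Proof.
move=> le_kN; rewrite /dp_coef le_kN ffunE coef_poly inordK //.
by case: ltnP => // le_j; rewrite nth_default // if_same.
Qed.

Lemma model_proj_component n u : model_proj n u \in model_component n.
Proof.
apply/model_componentP; split=> [/negPf n1 | k j le_kN /negPf neq].
  by rewrite /= n1.
by rewrite dp_coef_proj // neq.
Qed.

Lemma sum_fst m (c : nat -> model_carrier) :
  (\sum_(n < m) c n).1 = \sum_(n < m) (c n).1.
Proof. by elim/big_ind2: _ => // ? ? ? ? <- <-. Qed.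

Lemma sum_coef m (c : nat -> model_carrier) k j :
  (dp_coef (\sum_(n < m) c n).2 k)`_j = \sum_(n < m) (dp_coef (c n).2 k)`_j.
Proof.
elim: m => [|m IHm]; first by rewrite !big_ord0 dp_coef0 coef0.
by rewrite !big_ord_recr /= dp_coefD coefD IHm.
Qed.

Lemma model_component_sum u : exists n (c : nat -> model_carrier),
  (forall i, c i \in model_component i) /\ u = \sum_(i < n) c i.
Proof.
(* Exponents of [s] are at most [M], so degrees are at most [M N + N + 1]; moreover [B > 1] includes
   the degree of [x]. *)
pose M := (\max_(i : 'I_N.+1) size (u.2 i))%N; pose B := (M * N + N.+3)%N.
exists B, (fun n => model_proj n u); split=> [n|]; first exact: model_proj_component.
apply: model_eqP => [|k j le_kN].
  have lt_1B : (1 < B)%N by rewrite /B; lia.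
  rewrite (sum_fst B (model_proj^~ u)) (bigD1 (Ordinal lt_1B)) //= big1 ?addr0 // => i.
  by rewrite -val_eqE /= => /negPf->.
rewrite (sum_coef B (model_proj^~ u)); under eq_bigr => n _ do rewrite dp_coef_proj //.
have [lt_j | le_j] := ltnP j (size (dp_coef u.2 k)); last first.
  by rewrite (nth_default _ le_j) big1 // => n _; rewrite if_same.
have lt_B : (dp_deg k j < B)%N.
  have : (j <= M)%N.
    apply: leq_trans (leq_bigmax (inord k : 'I_N.+1)).
    by move: lt_j; rewrite /dp_coef le_kN => /ltnW.
  move/(leq_mul (leqnn N)); rewrite !(mulnC N) -(leq_add2r (N.+1 - k)) => le_M.
  apply: leq_ltn_trans le_M _.
  by rewrite /B ltn_add2l; lia.
rewrite (bigD1 (Ordinal lt_B)) //= eqxx big1 ?addr0 // => n.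
by rewrite -val_eqE /= eq_sym => /negPf->.
Qed.

Lemma model_component_direct m (c : nat -> model_carrier) :
  (forall i, c i \in model_component i) -> \sum_(i < m) c i = 0 ->
  forall i, (i < m)%N -> c i = 0.
Proof.
move=> cP sum0 n lt_nm.
have c1 (i : nat) : i != 1%N -> (c i).1 = 0 by case/model_componentP: (cP i).
have c2 (i k j : nat) : (k <= N)%N -> dp_deg k j != i -> (dp_coef (c i).2 k)`_j = 0.
  by case/model_componentP: (cP i) => _; apply.
apply: model_eqP => [|k j le_kN] /=.
  have [n1 | /c1//] := eqVneq n 1%N.
  have : (\sum_(i < m) c i).1 = 0 by rewrite sum0.
  rewrite sum_fst (bigD1 (Ordinal lt_nm)) //= big1 ?addr0 // => i.
  by rewrite -val_eqE /= n1 => /c1.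
rewrite dp_coef0 coef0; have [eq_n | neq] := eqVneq (dp_deg k j) n; last exact: c2.
have : (dp_coef (\sum_(i < m) c i).2 k)`_j = 0 by rewrite sum0 dp_coef0 coef0.
rewrite sum_coef (bigD1 (Ordinal lt_nm)) //= big1 ?addr0 // => i.
by rewrite -val_eqE /= -eq_n eq_sym => /(c2 _ _ _ le_kN).
Qed.

Definition model : gradedLieAlgebra F :=
  GradedLieAlgebra model_bracketxx model_jacobi model_component_submod
    model_component0 model_component_bracket model_component_sum
    model_component_direct.

(** * Products of monomials with the two generators *)

Local Notation X := ((1, 0) : model).
(* [t^(N-r) s^j], which is [[e x^r]] for [e = t^(N) s^j]. *)
Definition monomial j r : model := (0, dp_of (fun k => (k == N - r)%N%:R * 'X^j)).
Local Notation mon := monomial.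
Local Notation Y := (mon 0 0).

Lemma monomial_coef j r k i : (k <= N)%N ->
  (dp_coef (mon j r).2 k)`_i = ((k == N - r)%N && (i == j))%:R.
Proof.
move=> le_kN; rewrite dp_coef_of //; case: eqP => _ /=; last by rewrite mul0r coef0.
by rewrite mul1r coefXn.
Qed.

Lemma model_ad_x (u : model) : u ** X = (0, dp_der u.2).
Proof.
have d0 : dp_der (0 : divpow) = 0 by apply: linear0.
have c0 : dp_const (0 : divpow) = 0 by apply: linear0.
apply: model_eq => //; rewrite [LHS]/= d0 c0 scale1r scaler0 mulr0 mul0r.
by rewrite !subr0 mulr0 addr0.
Qed.

Lemma monomial_x j r : (r < N)%N -> mon j r ** X = mon j r.+1.
Proof.
move=> lt_rN; rewrite model_ad_x; apply: model_eqP => // k i le_kN.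
rewrite monomial_coef // dp_coef_der; case: (ltngtP k N) le_kN => // [lt_kN | ->] _.
  by rewrite monomial_coef //; congr ((_ && _)%:R); lia.
by rewrite dp_coef_out // coef0 (_ : (N == N - r.+1)%N = false) //; lia.
Qed.

Lemma monomial_x_top j : mon j N ** X = 0.
Proof.
rewrite model_ad_x; apply: model_eqP => // k i le_kN.
rewrite dp_coef_der dp_coef0 coef0; case: (ltngtP k N) le_kN => // [lt_kN | ->] _.
  by rewrite monomial_coef // subnn.
by rewrite dp_coef_out // coef0.
Qed.

Lemma dp_mul_delta f m k : (m <= N)%N -> (k <= N)%N ->
  dp_coef (f * dp_of (fun k => (k == m)%:R)) k =
  if (m <= k)%N then 'C(k, m)%:R * dp_coef f (k - m) else 0.
Proof.
move=> le_mN le_kN; rewrite dp_mulE // -hmul_delta; apply: eq_hmul => // i le_ik.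
by rewrite dp_coef_of // (leq_trans le_ik).
Qed.

Hypothesis N_gt4 : (4 < N)%N.

Lemma natr_predq : N%:R = -1 :> F.
Proof.
have : N.+1%:R = 0 :> F.
  rewrite N_primepow natrX; have := pcharf0 charF => ->.
  by rewrite expr0n; case: h N_primepow => [|//]; rewrite expn0; lia.
by rewrite -natr1 => /eqP; rewrite addr_eq0 => /eqP.
Qed.

(** The factor [t^(N-1)] sees only the coefficients [f_0] and [f_1] of [f], and [C(N, N-1) = N = -1]
    in the field. The term [- t^(N) f_0'] subtracts the value of [f_1] at [s = 0]; this doubling is
    what [dtype] records. *)
Lemma model_ad_y (u : model) k i : (k <= N)%N ->
  (dp_coef (u ** Y).2 k)`_i =
   (if k == N.-1 then (if i == 0%N then - u.1 else 0) + ('X * dp_coef u.2 0)`_i else 0)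
   - (if k == N then ('X * (dp_coef u.2 1 + ((dp_coef u.2 1)`_0)%:P))`_i else 0).
Proof.
move=> le_kN; pose t m : divpow := dp_of (fun k => (k == m)%:R).
have YE : Y = (0, t N) :> model_carrier.
  congr (_, _); apply: dp_eq => k' le_k'; rewrite !dp_coef_of //.
  by rewrite subn0 mulr1.
have dt : dp_der (t N) = t N.-1.
  apply: dp_eq => k' le_k'; rewrite dp_coef_der [RHS]dp_coef_of //.
  case: (ltngtP k' N) le_k' => // [lt_k' | ->] _; last first.
    by rewrite dp_coef_out // (_ : (N == N.-1)%N = false) //; lia.
  by rewrite dp_coef_of //; congr (_%:R); lia.
have ct m : dp_const (t m) = t m.
  apply: dp_eq => k' le_k'; rewrite dp_coef_const dp_coef_of //.
  by rewrite -polyC_natr coefC.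
have -> : u ** Y = (0, - (u.1 *: t N.-1) +
    dp_s * (u.2 * t N.-1 - dp_const (dp_der u.2) * t N)) :> model.
  rewrite YE; apply: model_eq => //; rewrite [LHS]/= dt ct scale0r sub0r.
  by rewrite [t N * _]mulrC.
rewrite /= dp_coefD dp_coefN dp_coefZ dp_coef_sM dp_coefD dp_coefN.
rewrite !dp_mul_delta //; last by lia.
rewrite dp_coef_of // dp_coef_const dp_coef_der.
have [-> | kN1] := eqVneq k N.-1.
  rewrite leqnn subnn binn mul1r (_ : (N <= N.-1)%N = false); last by lia.
  rewrite (_ : (N.-1 == N) = false); last by lia.
  rewrite !subr0 coefD coefN coefZ coef1; case: (i == 0%N); rewrite ?mulr1 //.
  by rewrite mulr0 oppr0.
rewrite scaler0 oppr0 sub0r add0r.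
have [-> | kN] := eqVneq k N; last first.
  rewrite (_ : (N.-1 <= k)%N = false); last by lia.
  rewrite (_ : (N <= k)%N = false); last by lia.
  by rewrite subr0 mulr0 coef0 oppr0.
rewrite leq_pred leqnn subnn binn mul1r (_ : (N - N.-1)%N = 1); last by lia.
rewrite -[in 'C(N, _)](prednK (n := N)) ?binSn ?prednK; try by lia.
rewrite -polyC_natr natr_predq polyCN polyC1 mulN1r -opprD mulrN coefN.
by [].
Qed.

Lemma monomial_y_low j r : (r.+1 < N)%N -> mon j r ** Y = 0.
Proof.
move=> lt_rN; apply: model_eqP => // k i le_kN; rewrite model_ad_y // dp_coef0 coef0.
have N_gt0 : (0 < N)%N by lia.
rewrite !coefXM coefD coefC.
rewrite !(monomial_coef _ _ _ (leq0n N)) !(monomial_coef _ _ _ N_gt0).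
have e0 : (0 == N - r)%N = false by lia.
have e1 : (1 == N - r)%N = false by lia.
rewrite e0 e1.
by do ?[case: ifP => _]; rewrite /= ?oppr0 ?addr0 ?subr0 ?oppr0.
Qed.

Lemma monomial_y_pred j : mon j N.-1 ** Y = - dtype F j *: mon j.+1 0.
Proof.
apply: model_eqP => [|k i le_kN]; first by rewrite /= scaler0.
rewrite model_ad_y // dp_coefZ coefZ (monomial_coef _ _ _ le_kN).
have N_gt0 : (0 < N)%N by lia.
rewrite !coefXM coefD coefC.
rewrite !(monomial_coef _ _ _ (leq0n N)) !(monomial_coef _ _ _ N_gt0).
have e0 : (0 == N - N.-1)%N = false by lia.
have e1 : (1 == N - N.-1)%N = true by lia.
rewrite e0 e1.
rewrite subn0 /= oppr0 !if_same addr0 if_same sub0r.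
case: eqP => //= _; last by rewrite oppr0 mulr0.
case: i => [|i] /=; first by rewrite oppr0 mulr0.
rewrite eqSS; have [-> | ne_ij] := eqVneq i j.
  by rewrite mulr1; case: j => [|j] //=; rewrite addr0.
rewrite mulr0 add0r; case: i ne_ij => [|i] ne_ij; last by rewrite /= oppr0.
by rewrite eqxx (negPf ne_ij) oppr0.
Qed.

Lemma monomial_y_top j : mon j N ** Y = mon j.+1 1.
Proof.
apply: model_eqP => // k i le_kN; rewrite model_ad_y // (monomial_coef _ _ _ le_kN).
have N_gt0 : (0 < N)%N by lia.
rewrite !coefXM coefD coefC.
rewrite !(monomial_coef _ _ _ (leq0n N)) !(monomial_coef _ _ _ N_gt0).
rewrite subnn subn1 /= oppr0 !if_same !addr0 !if_same subr0 add0r.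
case: eqP => //= _; case: i => [|i] //=; by rewrite ?if_same ?eqSS.
Qed.

Lemma monomial_comp j r : (r <= N)%N -> mon j r \in component model (j * N + r).+1.
Proof.
move=> le_rN; apply/model_componentP; split=> // k i le_kN neq.
rewrite monomial_coef //; case: andP => // -[/eqP kE /eqP iE].
by move: neq; rewrite kE iE /dp_deg; lia.
Qed.

Lemma X_comp1 : X \in component model 1.
Proof. by apply/model_componentP; split=> // k j _ _; rewrite dp_coef0 coef0. Qed.

Lemma monomial_span n (u : model) j r : (r <= N)%N -> u.1 = 0 ->
  u \in component model n ->
  (forall k i, (k <= N)%N -> dp_deg k i = n -> (k == N - r)%N && (i == j)) ->
  exists a, u = a *: mon j r.
Proof.
move=> le_rN u1 /model_componentP[_ u2] deg_n.
exists (dp_coef u.2 (N - r))`_j; apply: model_eqP => [|k i le_kN].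
  by rewrite /= u1 scaler0.
rewrite dp_coefZ coefZ monomial_coef //; case: andP => [[/eqP-> /eqP->]|ne].
  by rewrite mulr1.
rewrite mulr0 u2 //; apply/eqP=> /deg_n; move/(_ le_kN)/andP; exact: ne.
Qed.

Lemma monomial_span2 n (u : model) j r j' r' : (r <= N)%N -> (r' <= N)%N ->
  u.1 = 0 -> u \in component model n -> r != r' ->
  (forall k i, (k <= N)%N -> dp_deg k i = n ->
     (k == N - r)%N && (i == j) || (k == N - r')%N && (i == j')) ->
  exists a b, u = a *: mon j r + b *: mon j' r'.
Proof.
move=> le_rN le_rN' u1 /model_componentP[_ u2] ne_r deg_n.
exists (dp_coef u.2 (N - r))`_j, (dp_coef u.2 (N - r'))`_j'.
apply: model_eqP => [|k i le_kN]; first by rewrite /= u1 !scaler0 addr0.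
rewrite dp_coefD !dp_coefZ coefD !coefZ !monomial_coef //.
have excl : (N - r == N - r')%N = false by lia.
have := u2 k i le_kN; have := deg_n k i le_kN.
case: (k =P (N - r)%N) => [-> | _] /=.
  rewrite excl mulr0 addr0 /= orbF; case: (i =P j) => [-> | _] /= dn u2n.
    by rewrite mulr1.
  by rewrite mulr0 u2n //; apply/eqP => /dn.
rewrite mulr0 add0r; case: (k =P (N - r')%N) => [-> | _] /=.
  case: (i =P j') => [-> | _] /= dn u2n; first by rewrite mulr1.
  by rewrite mulr0 u2n //; apply/eqP => /dn.
by move=> dn u2n; rewrite mulr0 u2n //; apply/eqP => /dn.
Qed.

Lemma monomial_indep j r j' r' a b : (r <= N)%N -> (r' <= N)%N -> r != r' ->
  a *: mon j r + b *: mon j' r' = 0 -> a = 0 /\ b = 0.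
Proof.
move=> le_rN le_rN' ne_r sum0.
have coef k i : (k <= N)%N ->
    a * ((k == N - r)%N && (i == j))%:R + b * ((k == N - r')%N && (i == j'))%:R = 0.
  move=> le_kN; rewrite -!monomial_coef // -!coefZ -coefD -!dp_coefZ -dp_coefD.
  by rewrite [_ + _](_ : _ = (a *: mon j r + b *: mon j' r').2) // sum0 dp_coef0 coef0.
have [E1 E2] := (coef _ j (leq_subr r N), coef _ j' (leq_subr r' N)).
have e1 : (N - r == N - r')%N = false by lia.
have e2 : (N - r' == N - r)%N = false by lia.
move: E1 E2; rewrite e1 e2 !eqxx /= !mulr0 !mulr1 addr0 add0r; by split.
Qed.

Lemma monomial_neq0 j r : (r <= N)%N -> mon j r != 0.
Proof.
move=> le_rN; have [r' le_r' ne_r] : exists2 r', (r' <= N)%N & r != r'.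
  by case: (eqVneq r 0%N) => [->|]; [exists 1%N; lia | exists 0%N].
apply/eqP=> m0; have [|/eqP] := @monomial_indep j r j r' 1 0 le_rN le_r' ne_r.
  by rewrite m0 scaler0 scale0r addr0.
by rewrite oner_eq0.
Qed.

Lemma model_basis1 : is_basis (component model 1) [:: X; Y].
Proof.
apply/basis2P; split=> [||a b ab0|u uP].
- exact: X_comp1.
- exact: (@monomial_comp 0 0).
- have a0 : a = 0.
    have : a * 1 + b * 0 = 0 := congr1 fst ab0.
    by rewrite mulr1 mulr0 addr0.
  split=> //; move/eqP: ab0; rewrite a0 scale0r add0r scaler_eq0.
  by rewrite (negPf (monomial_neq0 _ (leq0n N))) orbF => /eqP.
have [] := @monomial_span 1 (u - u.1 *: X) 0 0.
- by [].
- have E : u.1 - u.1 * 1 = 0 :> F by rewrite mulr1 subrr.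
  exact: E.
- have [_ sub] := model_component_submod 1.
  by rewrite -scaleNr addrC; apply: sub => //; apply: X_comp1.
- move=> k i le_kN; rewrite /dp_deg; nia.
by move=> b eb; exists u.1, b; rewrite -eb addrC subrK.
Qed.

Lemma comp_gt1 n (u : model) : u \in component model n -> n != 1%N -> u.1 = 0.
Proof. by case/model_componentP. Qed.

Lemma model_basis_chain j r : (0 < r < N)%N ->
  is_basis (component model (j * N + r).+1) [:: mon j r].
Proof.
move=> rP; have le_rN : (r <= N)%N by lia.
apply/basis1P; split=> [||u uP].
- exact: monomial_comp.
- exact: monomial_neq0.
- apply: (monomial_span le_rN _ uP); first by apply: comp_gt1 uP _; lia.
  move=> k i le_kN; rewrite /dp_deg => deg.
  have ij : i = j by nia.
  by rewrite ij eqxx andbT; move: deg; rewrite ij; lia.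
Qed.

Lemma model_basis_diamond j :
  is_basis (component model (j.+1 * N).+1) [:: mon j N; mon j.+1 0].
Proof.
have N0 : N != 0%N by lia.
have topC := @monomial_comp j N (leqnn N); have botC := @monomial_comp j.+1 0 (leq0n N).
apply/basis2P; split=> [||a b|u uP].
- by rewrite mulSn addnC.
- by rewrite -[(_ * N)%N]addn0.
- exact: monomial_indep.
- apply: (monomial_span2 _ _ _ uP) => //; first by apply: comp_gt1 uP _; nia.
  move=> k i le_kN; rewrite /dp_deg subnn subn0 => deg.
  have [ij | ij] : i = j \/ i = j.+1 by nia.
    by rewrite ij eqxx; apply/orP; left; move: deg; rewrite ij; lia.
  by rewrite ij eqxx; apply/orP; right; move: deg; rewrite ij; lia.
Qed.

(** * The model is a Nottingham algebra *)

Variant degree_spec n : Prop :=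
  | Degree1 of n = 1%N
  | DegreeChain j r of (0 < r < N)%N & n = (j * N + r).+1
  | DegreeDiamond j of n = (j.+1 * N).+1.

Lemma degreeP n : (0 < n)%N -> degree_spec n.
Proof.
case: n => // n _; have nE := divn_eq n N; set j := (n %/ N)%N in nE *.
set r := (n %% N)%N in nE *; have lt_rN : (r < N)%N by rewrite ltn_pmod //; lia.
have [r0 | r_gt0] := posnP r; last by apply: (@DegreeChain _ j r); rewrite ?nE ?r_gt0.
case: j nE => [|j] nE; first by apply: Degree1; rewrite nE r0.
by apply: (@DegreeDiamond _ j); rewrite nE r0 addn0.
Qed.

Hypothesis p_gt3 : (3 < p)%N.

Lemma model_span_next n (z w : model) : (0 < n)%N -> z \in component model n ->
  z != 0 -> w \in component model n.+1 -> exists a b, w = a *: (z ** X) + b *: (z ** Y).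
Proof.
have dt0 j : dtype F j != 0.
  by case: j => [|j]; rewrite /= ?oner_eq0 ?(natr2_neq0 charF).
move=> /degreeP[nE | j r rP nE | j nE]; rewrite {n}nE => zC z0 wC.
- have /basis2P[_ _ _ /(_ _ zC)[a [b zE]]] := model_basis1.
  have /(model_basis_chain 0)/basis1P[_ _ /(_ _ wC)[c wE]] : (0 < 1 < N)%N by lia.
  have zX : z ** X = b *: mon 0 1.
    by rewrite zE brDl !brZl bracketxx scaler0 add0r monomial_x //; lia.
  have zY : z ** Y = - a *: mon 0 1.
    rewrite zE brDl !brZl bracketxx scaler0 addr0 brC monomial_x; last by lia.
    by rewrite scalerN scaleNr.
  have [b0 | b0] := eqVneq b 0; last first.
    by exists (c / b), 0; rewrite zX scalerA divfK // scale0r addr0.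
  have a0 : - a != 0.
    apply: contraNneq z0 => /eqP; rewrite oppr_eq0 zE b0 => /eqP->.
    by rewrite !scale0r addr0.
  by exists 0, (c / - a); rewrite zY scalerA divfK // scale0r add0r.
- have /basis1P[_ _ /(_ _ zC)[a zE]] := model_basis_chain j rP.
  have a0 : a != 0 by apply: contraNneq z0 => a0; rewrite zE a0 scale0r.
  have zX : z ** X = a *: mon j r.+1 by rewrite zE brZl monomial_x //; lia.
  (* Only just before a diamond are both products needed to span; elsewhere one nonzero product
     suffices. *)
  have [rN | rN] := eqVneq r.+1 N.
    have zY : z ** Y = (a * - dtype F j) *: mon j.+1 0.
      by rewrite zE brZl (_ : r = N.-1) ?monomial_y_pred ?scalerA //; lia.
    rewrite -addnS rN -mulSnr in wC.
    have /basis2P[_ _ _ /(_ _ wC)[c [d wE]]] := model_basis_diamond j.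
    have ad0 : a * - dtype F j != 0 by rewrite mulf_neq0 ?oppr_eq0.
    by exists (c / a), (d / (a * - dtype F j)); rewrite zX zY !scalerA !divfK // rN.
  have r1P : (0 < r.+1 < N)%N by lia.
  rewrite -addnS in wC.
  have /basis1P[_ _ /(_ _ wC)[c wE]] := model_basis_chain j r1P.
  by exists (c / a), 0; rewrite zX scalerA divfK // scale0r addr0.
- have /basis2P[_ _ _ /(_ _ zC)[a [b zE]]] := model_basis_diamond j.
  have r1P : (0 < 1 < N)%N by lia.
  rewrite -addn1 in wC.
  have /basis1P[_ _ /(_ _ wC)[c wE]] := model_basis_chain j.+1 r1P.
  have zX : z ** X = b *: mon j.+1 1.
    by rewrite zE brDl !brZl monomial_x_top scaler0 add0r monomial_x //; lia.
  have zY : z ** Y = a *: mon j.+1 1.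
    by rewrite zE brDl !brZl monomial_y_top monomial_y_low ?scaler0 ?addr0 //; lia.
  have [b0 | b0] := eqVneq b 0; last first.
    by exists (c / b), 0; rewrite zX scalerA divfK // scale0r addr0.
  have a0 : a != 0.
    by apply: contraNneq z0 => a0; rewrite zE a0 b0 !scale0r addr0.
  by exists 0, (c / a); rewrite zY scalerA divfK // scale0r add0r.
Qed.

Lemma model_covering : covering_property model.
Proof.
move=> n z n_gt0 zC z0 w; split=> [wC | [u uC ->]]; last first.
  by rewrite -addn1; apply: component_bracket.
have [a [b ->]] := model_span_next n_gt0 zC z0 wC.
exists (a *: X + b *: Y); last by rewrite brDr !brZr.
by apply: compD; apply: compZ; [apply: X_comp1 | apply: (@monomial_comp 0 0)].
Qed.

Lemma model_dims n : (0 < n)%N ->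
  has_dim (component model n) 1 \/ has_dim (component model n) 2.
Proof.
case/degreeP=> [-> | j r rP -> | j ->].
- by right; apply: has_dim2 model_basis1.
- by left; apply: has_dim1 (model_basis_chain j rP).
- by right; apply: has_dim2 (model_basis_diamond j).
Qed.

Lemma model_infinite : infinite_dimensional model.
Proof.
move=> n0 [b [_ _ span] nE]; subst n0; set n := size b in span.
have /fin_all_exists[c cP] (j : 'I_n.+1) : exists cj : 'I_n -> F,
    mon j 1 = \sum_(i < n) cj i *: b`_i by exact: span.
(* A matrix with one more row than columns has a nonzero left kernel vector, that is, a linear
   relation between the monomials [t^(N-1) s^j]. *)
pose A := \matrix_(j < n.+1, i < n) c j i.
have : kermx A != 0.
  rewrite kermx_eq0 /row_free; apply/eqP => rk.
  by have := rank_leq_col A; rewrite rk ltnn.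
case/rowV0Pn=> v /sub_kermxP vA /rV0Pn[k vk].
have sum0 : \sum_(j < n.+1) v 0 j *: mon j 1 = 0.
  under eq_bigr => j _ do rewrite cP scaler_sumr.
  rewrite exchange_big big1 //= => i _.
  under eq_bigr => j _ do rewrite scalerA.
  rewrite -scaler_suml; have /matrixP/(_ 0 i) := vA; rewrite !mxE => E.
  rewrite (_ : \sum_j _ = 0) ?scale0r // -[RHS]E.
  by apply: eq_bigr => j _; rewrite !mxE.
have N1 : (N - 1 <= N)%N by exact: leq_subr.
have coef_sum :=
  sum_coef n.+1 (fun j => v 0 (inord j) *: (mon j 1 : model_carrier)) (N - 1) k.
have sum0' : \sum_(j < n.+1) v 0 (inord j) *: (mon j 1 : model_carrier) = 0.
  by rewrite -[RHS]sum0; apply: eq_bigr => j _; rewrite inord_val.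
move: coef_sum; rewrite sum0' dp_coef0 coef0 => /esym.
rewrite (bigD1 k) //= big1 ?addr0 => [|j ne_j].
  rewrite inord_val dp_coefZ coefZ monomial_coef // !eqxx /= mulr1 => /eqP.
  by rewrite (negPf vk).
rewrite dp_coefZ coefZ monomial_coef // eqxx /= eq_sym (_ : (j == k :> nat) = false).
  by rewrite mulr0.
by apply: contraNF ne_j => /eqP/val_inj ->.
Qed.

Lemma model_thin : thin model.
Proof.
split; [exact: model_infinite | exact: has_dim2 model_basis1 | exact: model_dims
  | exact: model_covering | ].
by exists (1 * N).+1; [lia | apply: has_dim2 (model_basis_diamond 0)].
Qed.

Lemma model_dim2 m : (1 < m)%N -> has_dim (component model m) 2 ->
  exists j, m = (j.+1 * N).+1.
Proof.
move=> m_gt1 dim2; have [mE | j r rP mE | j mE] := degreeP (ltnW m_gt1).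
- by rewrite mE in m_gt1.
- case: (has_dim2_nbasis dim2 (_ : is_basis _ [:: mon j r])).
  by rewrite mE; apply: model_basis_chain.
- by exists j.
Qed.

Lemma model_second_diamond : second_diamond model N.+1.
Proof.
split; [lia | by rewrite -[N]mul1n; apply: has_dim2 (model_basis_diamond 0) |].
move=> i iP; case/model_dim2 => [|j iE]; first by lia.
by move: iP; rewrite iE; nia.
Qed.

Lemma monomial_liepow j r i : (r + i <= N)%N -> liepow (mon j r) X i = mon j (r + i).
Proof.
elim: i => [|i IHi] le_riN; first by rewrite addn0.
by rewrite liepowS IHi ?monomial_x ?addnS //; lia.
Qed.

Lemma monomial_relations j : diamond_relations X Y (dtype F j) (mon j N.-1).
Proof.
have xE : mon j N.-1 ** X = mon j N by rewrite monomial_x ?prednK //; lia.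
split; rewrite ?xE ?monomial_x_top ?monomial_y_top // monomial_y_pred brZl.
  by rewrite monomial_y_low ?scaler0 //; lia.
by rewrite monomial_x //; lia.
Qed.

Lemma model_standard : standard_generators (N.+1) X Y.
Proof.
have vE : liepow Y X (N.+1 - 2) = mon 0 N.-1.
  by rewrite monomial_liepow // ?add0n; try congr monomial; lia.
have [vxx vyy vyx] := monomial_relations 0.
have rP : (0 < N.-1 < N)%N by lia.
rewrite /standard_generators vE; split; first exact: model_basis1.
- move=> z zC; have r1 : (0 < 1 < N)%N by lia.
  have /basis1P[_ _ /(_ _ zC)[a ->]] := model_basis_chain 0 r1.
  by rewrite brZl monomial_y_low ?scaler0 //; lia.
- have := model_basis_chain 0 rP; rewrite mul0n add0n prednK //.
  by lia.
- by [].
- exact: vyx.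
Qed.

Lemma model_others : other_diamonds_infinite model N.+1.
Proof.
exists X, Y; split; first exact: model_standard.
have inf m : (1 < m)%N -> m != N.+1 -> has_dim (component model m) 2 ->
    infinite_type X Y m.
  move=> m_gt1 ne_mq dim2; split=> //.
  have [[|j] mE] := model_dim2 m_gt1 dim2; first by rewrite mE mul1n eqxx in ne_mq.
  exists (mon j.+1 N.-1); have [vxx vyy vyx] := monomial_relations j.+1.
  rewrite scaleN1r in vyx; split=> //; rewrite mE /=.
  have rP : (0 < N.-1 < N)%N by lia.
  have := model_basis_chain j.+1 rP.
  by rewrite (_ : (j.+1 * N + N.-1).+1 = (j.+2 * N)%N) // [in RHS]mulSn; lia.
(* A fake diamond can only follow a one-dimensional component, spanned by a monomial strictly inside
   a chain. There [[w x]] never vanishes, and [[w x x] = 0] forces [r = N - 1], where [[w y]] is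
   nonzero. *)
have chain m (w : model) : (1 < m)%N -> is_basis (component model m.-1) [:: w] ->
    exists j r a, [/\ (0 < r < N)%N, a != 0 & w = a *: mon j r].
  move=> m_gt1 wP; have m1_gt0 : (0 < m.-1)%N by lia.
  have [mE | j r rP mE | j mE] := degreeP m1_gt0.
  - by case: (has_dim2_nbasis (v := w) (has_dim2 model_basis1)); rewrite -mE.
  - rewrite mE in wP; case/basis1P: wP => wC w0 _.
    have /basis1P[_ _ /(_ _ wC)[a wE]] := model_basis_chain j rP.
    exists j, r, a; split=> //; apply: contraNneq w0 => a0.
    by rewrite wE a0 scale0r.
  - by case: (has_dim2_nbasis (v := w) (has_dim2 (model_basis_diamond j))); rewrite -mE.
move=> m m_gt1 ne_mq [dim2 | [_ [w [wP wxx wy]]] | [_ [w [wP wx _]]]].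
- exact: inf.
- have [j [r [a [rP a0 wE]]]] := chain m w m_gt1 wP; exfalso.
  have [lt_rN | le_Nr] := ltnP r.+1 N.
    move/eqP: wxx; rewrite wE !brZl !monomial_x; try by lia.
    by rewrite scaler_eq0 (negPf a0) (negPf (monomial_neq0 _ _)) //; lia.
  move/eqP: wy; rewrite wE brZl (_ : r = N.-1); last by lia.
  rewrite monomial_y_pred scalerA scaler_eq0 (negPf (monomial_neq0 _ _)) // orbF.
  rewrite mulf_eq0 (negPf a0) oppr_eq0 /=.
  by case: j {wE} => [|j]; rewrite /= ?oner_eq0 ?(negPf (natr2_neq0 charF p_gt3)).
- have [j [r [a [rP a0 wE]]]] := chain m w m_gt1 wP; exfalso.
  move/eqP: wx; rewrite wE brZl monomial_x; last by lia.
  by rewrite scaler_eq0 (negPf a0) (negPf (monomial_neq0 _ _)) //; lia.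
Qed.

Lemma model_nottingham : nottingham model.
Proof.
split; first exact: model_thin.
exists p, h; rewrite -N_primepow; split=> //; exact: model_second_diamond.
Qed.

End Derivation.
End DividedPowers.

(** * Uniqueness *)

Section GradedIsomorphism.
Variables (F : fieldType) (L M : gradedLieAlgebra F) (x y : L) (x' y' : M).
Hypotheses (thinL : thin L) (thinM : thin M).
Hypotheses (xyP : is_basis (component L 1) [:: x; y])
           (xyP' : is_basis (component M 1) [:: x'; y']).
Variable f : {linear L -> M}.
Hypotheses (fx : f x = x') (fy : f y = y').
Hypotheses (f_adx : forall a, f (a ** x) = f a ** x')
           (f_ady : forall a, f (a ** y) = f a ** y').

(** By covering, [x] and [y] generate the algebra. *)
Lemma component_ind (P : nat -> L -> Prop) :
  (forall n a b u v, P n u -> P n v -> P n (a *: u + b *: v)) ->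
  P 0 0 -> P 1 x -> P 1 y ->
  (forall n u, u \in component L n -> P n u -> P n.+1 (u ** x) /\ P n.+1 (u ** y)) ->
  forall n u, u \in component L n -> P n u.
Proof.
move=> PD P0 Px Py PS; elim=> [|[|n] IHn] u.
- by rewrite component0 inE => /eqP->.
- by case/basis2P: xyP => _ _ _ span /span[a [b ->]]; apply: PD.
have [z zC z0] := comp_neq0 thinL (ltn0Sn n).
case/(cover thinL xyP (ltn0Sn n) zC z0) => a [b ->].
by have [] := PS _ z zC (IHn z zC); apply: PD.
Qed.

Lemma morph_comb a b u v : f (a *: u + b *: v) = a *: f u + b *: f v.
Proof. by rewrite linearP linearZ. Qed.

(** The identity, for all [a], passes from [b] to [[b x]] and [[b y]] by the Jacobi identity, so
    compatibility with the generators is enough. *)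
Lemma morph_bracket a b : f (a ** b) = f a ** f b.
Proof.
have [n [c [cC ->]]] := component_sum b.
rewrite br_sumr !linear_sum; apply: eq_bigr => i _.
move: (nat_of_ord i) (c i) (cC i) a => m {}b.
apply: (@component_ind (fun _ u => forall a, f (a ** u) = f a ** f u)).
- by move=> _ r s u v IHu IHv a; rewrite brDr !brZr !morph_comb IHu IHv brDr !brZr.
- by move=> a; rewrite br0r (linear0 f) br0r.
- by move=> a; rewrite fx.
- by move=> a; rewrite fy.
move=> _ u _ IHu; split=> a.
  by rewrite br_ad linearB /= !f_adx !IHu !f_adx br_ad.
by rewrite br_ad linearB /= !f_ady !IHu !f_ady br_ad.
Qed.

Lemma morph_component n a : a \in component L n -> f a \in component M n.
Proof.
apply: (@component_ind (fun n u => f u \in component M n)).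
- by move=> {}n r s u v uC vC; rewrite morph_comb; apply: compD; apply: compZ.
- by rewrite linear0 comp0.
- by rewrite fx (x_comp xyP').
- by rewrite fy (y_comp xyP').
by move=> {}n u _ uC; rewrite f_adx f_ady (comp_x xyP') ?(comp_y xyP').
Qed.

Lemma morph_onto n v : v \in component M n -> exists2 u, u \in component L n & f u = v.
Proof.
elim: n v => [|[|n] IHn] v.
- by rewrite component0 inE => /eqP->; exists 0; rewrite ?comp0 ?linear0.
- case/basis2P: xyP' => _ _ _ span /span[a [b ->]].
  exists (a *: x + b *: y); last by rewrite morph_comb fx fy.
  by apply: compD; apply: compZ; rewrite ?(x_comp xyP) ?(y_comp xyP).
have [z' z'C z'0] := comp_neq0 thinM (ltn0Sn n).
case/(cover thinM xyP' (ltn0Sn n) z'C z'0) => a [b ->].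
have [z zC fz] := IHn z' z'C; exists (a *: (z ** x) + b *: (z ** y)).
  by apply: compD; apply: compZ; rewrite ?(comp_x xyP) ?(comp_y xyP).
by rewrite morph_comb f_adx f_ady fz.
Qed.

(** A nonzero [a] in the kernel would, by covering, put the whole next component into the kernel,
    although that component maps onto a nonzero one. *)
Lemma morph_component_eq0 n a : a \in component L n -> f a = 0 -> a = 0.
Proof.
case: n => [|n] aC fa; first by move: aC; rewrite component0 inE => /eqP.
apply/eqP/negPn/negP=> a0.
have [v vC] := comp_neq0 thinM (ltn0Sn n.+1).
have [u uC <-] := morph_onto vC.
have [r [s ->]] := cover thinL xyP (ltn0Sn n) aC a0 uC.
by rewrite morph_comb f_adx f_ady fa !br0l !scaler0 addr0 eqxx.
Qed.

Lemma morph_eq0 a : f a = 0 -> a = 0.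
Proof.
have [n [c [cC ->]]] := component_sum a; rewrite linear_sum => sum0.
rewrite big1 // => i _; apply: morph_component_eq0 (cC i) _.
by apply: (component_direct (fun j => morph_component (cC j)) sum0).
Qed.

Lemma morph_surj v : exists u, f u == v.
Proof.
have [n [c [cC ->]]] := component_sum v.
elim/big_rec: _ => [|i v' _ [u /eqP <-]]; first by exists 0; rewrite linear0.
by have [w _ <-] := morph_onto (cC i); exists (w + u); rewrite linearD.
Qed.

Lemma graded_isomorphism : graded_isomorphic L M.
Proof.
have f_injective : injective f.
  move=> a b fab; apply/eqP; rewrite -subr_eq0; apply/eqP/morph_eq0.
  by rewrite linearB fab subrr.
exists f; split; last 2 first.
- exact: morph_bracket.
- move=> i a; apply/idP/idP => [/morph_onto[u uC /f_injective <-] | /morph_component] //.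
have fK v : f (xchoose (morph_surj v)) = v by apply/eqP/(xchooseP (morph_surj v)).
by exists (fun v => xchoose (morph_surj v)) => // a; apply: f_injective; rewrite fK.
Qed.
End GradedIsomorphism.

(** * Linear maps out of F[s] *)

Section PolyMap.
Variables (F : fieldType) (V : lmodType F).
Implicit Types (b : nat -> V) (P Q : {poly F}).

Definition polymap b P : V := \sum_(j < size P) P`_j *: b j.

Lemma polymapE b P n : (size P <= n)%N -> polymap b P = \sum_(j < n) P`_j *: b j.
Proof.
move=> /subnKC <-; rewrite big_split_ord /= [X in _ + X]big1 ?addr0 // => i _.
by rewrite nth_default ?scale0r // leq_addr.
Qed.

Lemma polymap_linear b a P Q : polymap b (a *: P + Q) = a *: polymap b P + polymap b Q.
Proof.
pose n := maxn (size P) (size Q).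
have sPQ : (size (a *: P + Q)%R <= n)%N.
  apply: leq_trans (size_polyD _ _) _; rewrite geq_max !leq_max leqnn orbT.
  by rewrite (leq_trans (size_scale_leq _ _)).
rewrite (polymapE b sPQ) (polymapE b (leq_maxl _ _ : (size P <= n)%N)).
rewrite (polymapE b (leq_maxr _ _ : (size Q <= n)%N)) scaler_sumr -big_split /=.
by apply: eq_bigr => i _; rewrite coefD coefZ scalerDl scalerA.
Qed.

Lemma polymap0 b : polymap b 0 = 0.
Proof. by rewrite /polymap size_poly0 big_ord0. Qed.

Lemma polymapD b P Q : polymap b (P + Q) = polymap b P + polymap b Q.
Proof. by rewrite -[P]scale1r polymap_linear !scale1r. Qed.

Lemma polymapN b P : polymap b (- P) = - polymap b P.
Proof. by apply/eqP; rewrite -addr_eq0 -polymapD addNr polymap0. Qed.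

Lemma polymapC b c : polymap b c%:P = c *: b 0%N.
Proof. by rewrite (@polymapE _ _ 1) ?size_polyC_leq1 // big_ord1 coefC. Qed.

Lemma polymapXM b P : polymap b ('X * P) = polymap (fun j => b j.+1) P.
Proof.
rewrite (@polymapE _ _ (size P).+1); last first.
  by apply: leq_trans (size_polyMleq _ _) _; rewrite size_polyX.
rewrite big_ord_recl coefXM scale0r add0r; apply: eq_bigr => i _.
by rewrite lift0 coefXM.
Qed.

Lemma eq_polymap b b' P : b =1 b' -> polymap b P = polymap b' P.
Proof. by move=> eq_b; apply: eq_bigr => i _; rewrite eq_b. Qed.

Lemma polymap_eq0 b P : (forall j, b j = 0) -> polymap b P = 0.
Proof. by move=> b0; apply: big1 => i _; rewrite b0 scaler0. Qed.

(** The extra term for [j = 0] matches the doubled constant coefficient in [model_ad_y]. *)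
Lemma polymap_dtype b P :
  polymap (fun j => - dtype F j *: b j) P = - (polymap b P + P`_0 *: b 0%N).
Proof.
rewrite (@polymapE _ P (size P).+1) // (@polymapE b P (size P).+1) //.
rewrite !big_ord_recl.
have -> : P`_0 *: (- dtype F 0 *: b 0%N) = - (P`_0 *: b 0%N + P`_0 *: b 0%N).
  by rewrite scalerA -scalerDl -scaleNr /=; congr (_ *: _); ring.
rewrite -[X in _ + X]opprK -sumrN -opprD addrAC; congr (- (_ + _ + _)).
by apply: eq_bigr => i _; rewrite scaleN1r scalerN opprK.
Qed.
End PolyMap.

(** * The linear map from the model *)

Section ModelMap.
Variables (F : fieldType) (N p h : nat).
Hypotheses (charF : p \in [pchar F]) (N_primepow : N.+1 = (p ^ h)%N).
Hypothesis N_gt4 : (4 < N)%N.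
Variables (M : gradedLieAlgebra F) (x y : M) (e : nat -> M).
Hypotheses (e0 : e 0 = y) (e_x : forall j, liepow (e j) x N.+1 = 0)
  (e_y : forall j i, (i.+1 < N)%N -> liepow (e j) x i ** y = 0)
  (e_y_pred : forall j, liepow (e j) x N.-1 ** y = - dtype F j *: e j.+1)
  (e_y_top : forall j, liepow (e j) x N ** y = e j.+1 ** x).
Local Notation L := (model charF N_primepow).
Local Notation X := ((1, 0) : L).
Local Notation Y := (monomial charF N_primepow 0 0).
Implicit Types (u v : L).

(** The family [e] stands for the [t^(N) s^j], from which [x] produces all other monomials; this
    leaves no choice for the map. *)
Definition model_map u : M :=
  u.1 *: x + \sum_(i < N.+1) polymap (fun j => liepow (e j) x (N - i)) (dp_coef u.2 i).

Lemma model_map_linear : linear model_map.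
Proof.
move=> a u v; rewrite /model_map scalerDr addrACA; congr (_ + _).
  by rewrite scalerA -scalerDl.
rewrite scaler_sumr -big_split; apply: eq_bigr => i _ /=.
by rewrite dp_coefD dp_coefZ polymap_linear.
Qed.
HB.instance Definition _ := GRing.isLinear.Build F L M _ model_map model_map_linear.

Lemma polymap_br (b : nat -> M) P z : polymap b P ** z = polymap (fun j => b j ** z) P.
Proof. by rewrite /polymap linear_sumlz; apply: eq_bigr => i _; rewrite brZl. Qed.

Lemma model_map_X : model_map X = x.
Proof.
rewrite /model_map scale1r big1 ?addr0 // => i _.
by rewrite dp_coef0 polymap0.
Qed.

Lemma model_map_Y : model_map Y = y.
Proof.
rewrite /model_map scale0r add0r (bigD1 ord_max) //= big1 ?addr0 => [|i ne_i].
  by rewrite dp_coef_of // subn0 eqxx mul1r subnn expr0 -polyC1 polymapC scale1r e0.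
have le_iN : (i <= N)%N by rewrite -ltnS.
rewrite dp_coef_of // subn0 (_ : (i == N :> nat) = false) ?mul0r ?polymap0 //.
by apply: contraNF ne_i => /eqP iN; apply/eqP/val_inj.
Qed.

Lemma model_map_adx u : model_map (u ** X) = model_map u ** x.
Proof.
rewrite model_ad_x /model_map scale0r add0r brDl brZl bracketxx scaler0 add0r.
(* The two sums agree after a shift: the last term on the left has no coefficient, and the first one
   on the right dies by [e_x]. *)
rewrite linear_sumlz big_ord_recr [RHS]big_ord_recl /=.
rewrite dp_coef_der dp_coef_out // polymap0.
rewrite polymap_br polymap_eq0 => [|j]; last by rewrite subn0 -liepowS e_x.
rewrite addr0 add0r; apply: eq_bigr => i _; rewrite polymap_br dp_coef_der.
rewrite -[bump 0 i]/i.+1; apply: eq_polymap => j.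
by rewrite -liepowS -subSn ?ltn_ord.
Qed.

Lemma model_ad_y_coef u k : (k <= N)%N -> dp_coef (u ** Y).2 k =
   (if k == N.-1 then - u.1%:P + 'X * dp_coef u.2 0 else 0)
   - (if k == N then 'X * (dp_coef u.2 1 + ((dp_coef u.2 1)`_0)%:P) else 0).
Proof.
move=> le_kN; apply/polyP => i; rewrite model_ad_y // coefB.
congr (_ - _); case: ifP => _; rewrite ?coef0 // coefD coefN coefC.
by case: eqP; rewrite ?oppr0.
Qed.

Lemma model_map_ady u : model_map (u ** Y) = model_map u ** y.
Proof.
rewrite /model_map scale0r add0r brDl brZl linear_sumlz.
(* On the left only the coefficients [N - 1] and [N] are nonzero, on the right [e_y] leaves only the
   indices 0 and 1; both sides reduce to this expression. *)
transitivity (- (u.1 *: (e 0 ** x)) + polymap (fun j => e j.+1 ** x) (dp_coef u.2 0)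
   - (polymap (fun j => e j.+1) (dp_coef u.2 1) + (dp_coef u.2 1)`_0 *: e 1)).
  pose i1 : 'I_N.+1 := inord N.-1.
  have i1E : i1 = N.-1 :> nat by rewrite inordK //; lia.
  rewrite (bigD1 ord_max) //= (bigD1 i1) /=; last by rewrite -val_eqE /= i1E; lia.
  rewrite big1 => [|i /andP[ne1 ne2]]; last first.
    rewrite -val_eqE /= in ne1; rewrite -val_eqE /= i1E in ne2.
    have le_iN : (i <= N)%N by rewrite -ltnS.
    by rewrite model_ad_y_coef // (negPf ne1) (negPf ne2) subr0 polymap0.
  rewrite i1E !model_ad_y_coef //; last by lia.
  have n1 : (N == N.-1) = false by lia.
  have n2 : (N.-1 == N) = false by lia.
  have n3 : (N - N.-1 = 1)%N by lia.
  rewrite !eqxx n1 n2 n3 subnn subr0 sub0r addr0 addrC.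
  rewrite polymapD !polymapN polymapC !polymapXM polymapD polymapC.
  by [].
have lt_1N : (1 < N.+1)%N by lia.
rewrite (bigD1 ord0) //= (bigD1 (Ordinal lt_1N)) //= big1 => [|i /andP[ne0 ne1]].
  rewrite addr0 !polymap_br subn0 subn1 (eq_polymap _ e_y_top).
  rewrite (eq_polymap _ e_y_pred) polymap_dtype addrA; congr (_ + _ + _).
  by rewrite [x ** y]brC scalerN e0.
rewrite -!val_eqE /= in ne0 ne1; rewrite polymap_br polymap_eq0 // => j.
by apply: e_y; have := ltn_ord i; lia.
Qed.

End ModelMap.

Section Uniqueness.
Variables (F : fieldType) (N p h : nat).
Hypotheses (charF : p \in [pchar F]) (N_primepow : N.+1 = (p ^ h)%N).
Hypothesis N_gt4 : (4 < N)%N.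

Lemma nottingham_model_unique (M : gradedLieAlgebra F) : (3 < p)%N ->
  nottingham M -> second_diamond M N.+1 -> other_diamonds_infinite M N.+1 ->
  graded_isomorphic (model charF N_primepow) M.
Proof.
move=> p_gt3 [thinM _] [_ dim_q dim_lt_q] [x [y [std others]]].
have [xyP comp2y v1P [v1xx v1yy] v1yx] := std.
have p_prime := pcharf_prime charF.
have h_gt0 : (0 < h)%N by case: h N_primepow => [|//]; rewrite expn0; lia.
have q_odd : odd N.+1.
  by rewrite N_primepow oddX; case: (even_prime p_prime) => [p2|->]; [lia | rewrite orbT].
have p_q : (p %| N.+1)%N by rewrite N_primepow dvdn_exp.
have v1_rel : diamond_relations x y 2 (liepow y x (N.+1 - 2)) by split.
rewrite -subn1 in v1P.
have rungs := rungP charF p_gt3 (N_gt4 : (5 < N.+1)%N) q_odd thinM xyP comp2y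
  v1_rel v1P dim_q dim_lt_q p_q others N_primepow.
have e_x j : liepow (rung x y N.+1 j) x N.+1 = 0.
  have [[vxx _ _] _ _ _] := rungs j.
  by apply: (liepow_eq0 (m := (N.+1 - 2).+2) vxx); lia.
have e_y j i : (i.+1 < N)%N -> liepow (rung x y N.+1 j) x i ** y = 0.
  by move=> lt_iN; have [_ -> //] := rungs j; lia.
have vE : (N.+1 - 2 = N.-1)%N by lia.
have e_y_pred j :
    liepow (rung x y N.+1 j) x N.-1 ** y = - dtype F j *: rung x y N.+1 j.+1.
  by rewrite /= vE scalerA mulrNN divff ?scale1r ?(dtype_neq0 charF).
have e_y_top j : liepow (rung x y N.+1 j) x N ** y = rung x y N.+1 j.+1 ** x.
  rewrite (rungS_x charF p_gt3 (rungs j)) vE -liepowS prednK //; lia.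
pose f : {linear model charF N_primepow -> M} :=
  @model_map _ _ _ _ charF N_primepow M x (rung x y N.+1).
apply: (@graded_isomorphism _ _ _ _ _ x y (model_thin charF N_primepow N_gt4 p_gt3)
  thinM (model_basis1 charF N_primepow N_gt4) xyP f) => //.
- exact: model_map_X.
- by apply: model_map_Y.
- by move=> a; apply: model_map_adx.
- by move=> a; apply: model_map_ady.
Qed.

End Uniqueness.

Theorem theorem2 (p q : nat) (F : fieldType)
  (p_prime : prime p) (p_gt3 : (3 < p)%N)
  (q_pow : exists h : nat, q = (p ^ h)%N) (q_gt5 : (5 < q)%N)
  (charF : p \in [pchar F]%R) :
  exists L : gradedLieAlgebra F,
    [/\ nottingham L, second_diamond L q & other_diamonds_infinite L q] /\
    forall M : gradedLieAlgebra F,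
      [/\ nottingham M, second_diamond M q & other_diamonds_infinite M q] ->
      graded_isomorphic L M.
Proof.
case: q_pow => h; case: q q_gt5 => // N N_gt4 N_primepow.
exists (model charF N_primepow); split=> [|M [nottM diamondM othersM]].
  split; [exact: model_nottingham | exact: model_second_diamond | exact: model_others].
exact: nottingham_model_unique.
Qed.
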